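(* Let $\Omega$ be an alphabet, and let $P$ be a non-trivial computable finite probability space on $\Omega$. Let $\alpha\in\Omega^\infty$ be Schnorr $P$-random. Let $t$ be an arbitrary positive real. Then the following conditions (i) and (ii) are equivalent: (i) There exists $M\in\mathbb{N}^+$ such that for every integer $n\ge M$ and every $k\in\mathbb{N}^+$, if $k\ge n^t$ then for every $a\in\Omega$ it holds that $$\left|\frac{N_a(\alpha\restriction_k)}{k}-P(a)\right|<\frac{1}{n}.$$ (ii) $t>2$.
   Context: $\mathbb{N}=\{0,1,2,\dots\}$ and $\mathbb{N}^+$ is the set of positive integers. An alphabet is a non-empty finite set. For an alphabet $\Omega$, $\Omega^*$ is the set of finite strings over $\Omega$ (including the empty string) and $\Omega^\infty$ is the set of infinite sequences $\alpha=\alpha(1)\alpha(2)\cdots$ over $\Omega$; $\alpha\restriction_n$ is the string of the first $n$ elements of $\alpha$. For $a\in\Omega$ and $\sigma\in\Omega^*$, $N_a(\sigma)$ is the number of occurrences of $a$ in $\sigma$. For $S\subset\Omega^*$, $[S]^{\prec}=\{\alpha\in\Omega^\infty\mid \exists n\in\mathbb{N}\ \alpha\restriction_n\in S\}$. A finite probability space on $\Omega$ is a function $P\colon\Omega\to\mathbb{R}$ with $P(a)\ge 0$ for all $a\in\Omega$ and $\sum_{a\in\Omega}P(a)=1$. It is called non-trivial if $P(a)<1$ for every $a\in\Omega$ (equivalently, there exists $a\in\Omega$ with $0<P(a)<1$). A real $x$ is computable if there is a total recursive $f\colon\mathbb{N}\to\mathbb{Q}$ with $|x-f(k)|<2^{-k}$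 for all $k\in\mathbb{N}$; $P$ is computable if $P(a)$ is a computable real for every $a\in\Omega$. The Bernoulli measure $\lambda_P$ is the probability measure on the Borel $\sigma$-field of $\Omega^\infty$ (generated by all sets $[S]^{\prec}$) with $\lambda_P([\{\sigma_1\cdots\sigma_n\}]^{\prec})=P(\sigma_1)\cdots P(\sigma_n)$ for every string $\sigma_1\cdots\sigma_n\in\Omega^*$. A Martin-Löf $P$-test is an r.e. (recursively enumerable) set $\mathcal{C}\subset\mathbb{N}^+\times\Omega^*$ such that $\lambda_P([\mathcal{C}_n]^{\prec})<2^{-n}$ for every $n\in\mathbb{N}^+$, where $\mathcal{C}_n=\{\sigma\mid(n,\sigma)\in\mathcal{C}\}$. A Schnorr $P$-test is a Martin-Löf $P$-test $\mathcal{C}$ for which there is a total recursive $f\colon\mathbb{N}^+\times\mathbb{N}\to\mathbb{Q}$ with $|\lambda_P([\mathcal{C}_n]^{\prec})-f(n,k)|<2^{-k}$ for all $n\in\mathbb{N}^+$, $k\in\mathbb{N}$. A sequence $\alpha\in\Omega^\infty$ passes $\mathcal{C}$ if $\alpha\notin[\mathcal{C}_n]^{\prec}$ for some $n\in\mathbb{N}^+$. $\alpha$ is Schnorr $P$-random if it passes every Schnorr $P$-test. *)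

(* Defs.v *)
From HB Require Import structures.
From mathcomp Require Import all_boot all_order all_algebra.
From mathcomp Require Import all_classical all_reals all_analysis.

Set Implicit Arguments.
Unset Strict Implicit.
Unset Printing Implicit Defensive.

Import Order.TTheory GRing.Theory Num.Theory.

Local Open Scope classical_set_scope.
Local Open Scope ring_scope.

(** Partial recursive functions on the natural numbers: [recf n] is the type of
    programs of arity [n], and [reval c v r] says that [c] halts on input [v]
    with output [r]. *)
Inductive recf : nat -> Type :=
| rzero n : recf n
| rsucc : recf 1
| rproj n (i : 'I_n) : recf n
| rcomp m n (f : recf m) (g : 'I_m -> recf n) : recf n
| rprim n (f : recf n) (g : recf n.+2) : recf n.+1
| rmin n (f : recf n.+1) : recf n.

(* [prim_rel base step y] relates to r when r = s_y for some s_0, ..., s_y with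
   [base s_0] and [step i s_i s_(i+1)] for all i < y. *)
Fixpoint prim_rel (base : nat -> Prop) (step : nat -> nat -> nat -> Prop)
    (y : nat) (r : nat) : Prop :=
  if y is y'.+1 then exists2 s, prim_rel base step y' s & step y' s r
  else base r.

(* [rprim f g] computes the h with h(0, x) = f(x), h(y + 1, x) = g(y, h(y, x), x);
   [rmin f] maps x to the least y with f(y, x) = 0, all earlier values being
   defined. *)
Fixpoint reval n (c : recf n) : n.-tuple nat -> nat -> Prop :=
  match c in recf n return n.-tuple nat -> nat -> Prop with
  | rzero _ => fun _ r => r = 0%N
  | rsucc => fun v r => r = (thead v).+1
  | rproj _ i => fun v r => r = tnth v i
  | @rcomp m _ f g => fun v r =>
      exists2 w : m.-tuple nat, (forall i, reval (g i) v (tnth w i)) & reval f w r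
  | @rprim n f g => fun v =>
      let x := behead_tuple v in
      prim_rel (reval f x)
        (fun y s => reval g (cons_tuple y (cons_tuple s x))) (thead v)
  | @rmin n f => fun v r =>
      reval f (cons_tuple r v) 0%N /\
      forall y, (y < r)%N -> exists s, reval f (cons_tuple y v) s.+1
  end.

Definition recursive n (F : n.-tuple nat -> nat) : Prop :=
  exists c : recf n, forall v r, reval c v r <-> r = F v.

Definition re_rel n (A : n.-tuple nat -> Prop) : Prop :=
  exists c : recf n, forall v, A v <-> exists r, reval c v r.

Definition recursive_rat n (F : n.-tuple nat -> rat) : Prop :=
  exists p q d : n.-tuple nat -> nat,
    [/\ recursive p, recursive q, recursive d &
        forall v, F v = ((p v)%:R - (q v)%:R) / (d v).+1%:R].

Definition recursive_rat1 (f : nat -> rat) : Prop :=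
  recursive_rat (fun v : 1.-tuple nat => f (tnth v ord0)).

Definition recursive_rat2 (f : nat -> nat -> rat) : Prop :=
  recursive_rat (fun v : 2.-tuple nat => f (tnth v ord0) (tnth v ord_max)).

Definition computable_real (R : realType) (x : R) : Prop :=
  exists2 f : nat -> rat, recursive_rat1 f &
    forall k : nat, `|x - ratr (f k)| < 2 ^- k.

(* Pointedness expresses non-emptiness; it also provides the pointed structure
   that the library requires of a measurable space. *)
#[short(type="alphabetType")]
HB.structure Definition Alphabet := {T of Finite T & isPointed T}.

(* The element alpha(i + 1) of an infinite sequence is [alpha i]; [cylinder S] is
   the open set of sequences having a prefix in S. *)
Definition cylinder (Omega : alphabetType) (S : set (seq Omega)) : set (nat -> Omega) :=
  [set alpha | exists n, S (mkseq alpha n)].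

Definition infseq (Omega : alphabetType) := g_sigma_algebraType (range (@cylinder Omega)).

HB.instance Definition _ (Omega : alphabetType) := Measurable.on (infseq Omega).

Definition finite_probability (R : realType) (Omega : alphabetType) (P : Omega -> R) :=
  (forall a, 0 <= P a) /\ \sum_(a : Omega) P a = 1.

Definition nontrivial (R : realType) (Omega : alphabetType) (P : Omega -> R) :=
  forall a, P a < 1.

Definition computable_probability (R : realType) (Omega : alphabetType)
  (P : Omega -> R) := forall a, computable_real (P a).

Definition bernoulli_measure (R : realType) (Omega : alphabetType) (P : Omega -> R)
    (mu : probability (infseq Omega) R) : Prop :=
  forall s : seq Omega, mu (cylinder [set s]) = (\prod_(a <- s) P a)%:E.

(* Any two numberings of the finite alphabet differ by a recursive function, so
   the choice of [enum_rank] is immaterial. *)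
Definition string_code (Omega : alphabetType) (s : seq Omega) : nat :=
  CodeSeq.code [seq nat_of_ord (enum_rank a) | a <- s].

Definition re_set (Omega : alphabetType) (C : set (nat * seq Omega)) : Prop :=
  re_rel (fun v : 2.-tuple nat =>
    exists n s, C (n, s) /\ v = [tuple n; string_code s]).

Definition tsection (Omega : alphabetType) (C : set (nat * seq Omega)) (n : nat) :
  set (seq Omega) := [set s | C (n, s)].

Section Tests.
Context (R : realType) (Omega : alphabetType).
Implicit Types (mu : probability (infseq Omega) R) (C : set (nat * seq Omega)).

Definition martin_lof_test mu C : Prop :=
  [/\ forall n s, C (n, s) -> (0 < n)%N,
      re_set C &
      forall n, (0 < n)%N -> (mu (cylinder (tsection C n)) < (2 ^- n)%:E)%E].

(* The value of [f] at [n = 0] is irrelevant: a recursive function on N+ x N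
   extends to a recursive function on N x N. *)
Definition schnorr_test mu C : Prop :=
  martin_lof_test mu C /\
  exists2 f : nat -> nat -> rat, recursive_rat2 f &
    forall n k, (0 < n)%N ->
      `|fine (mu (cylinder (tsection C n))) - ratr (f n k)| < 2 ^- k.

Definition passes C (alpha : nat -> Omega) : Prop :=
  exists2 n, (0 < n)%N & ~ cylinder (tsection C n) alpha.

Definition schnorr_random mu (alpha : nat -> Omega) : Prop :=
  forall C, schnorr_test mu C -> passes C alpha.

End Tests.

(* Main.v *)
Require Import Defs.
From HB Require Import structures.
From mathcomp Require Import all_boot all_order all_algebra.
From mathcomp Require Import all_classical all_reals all_analysis.
From mathcomp Require Import zify ring lra.

Set Implicit Arguments.
Unset Strict Implicit.
Unset Printing Implicit Defensive.

Import Order.TTheory GRing.Theory Num.Theory.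
Local Open Scope classical_set_scope.
Local Open Scope ring_scope.

(** Fix a letter [a] and let [S_k] count its occurrences among the first [k]
    letters. A Borel-Cantelli principle holds for Schnorr randomness: if the
    [j]-th event depends recursively on the positions of [a] in a prefix of
    recursive length and has probability O(2^-j), then a Schnorr random sequence
    lies in finitely many of the events, since the tail unions form a Schnorr test
    whose measures are computed by exhausting bit strings.

    If [t > 2], Kolmogorov's maximal inequality shows that the event that
    [|S_k - k P a|] reaches [2^((u+1)j)] for some [k <= 2^((2u+1)(j+1))] has
    probability O(2^-j); for [u] large this beats the permitted deviation
    [k / n >= k^(1 - 1/t)].

    If [t <= 2], condition (i) at [n = 2^i], [k = 4^i] gives
    [|S_k - k P a| < sqrt k] at all large powers [k] of 4, which bounds the
    deviation over each of the independent blocks between consecutive powers by a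
    constant multiple of its standard deviation. Comparing with a slightly
    biased coin, each block violates this with a probability bounded away from 0,
    so that staying bounded over many blocks is exponentially unlikely. *)

(** * Recursive functions *)

Definition env_tuple n (e : nat -> nat) : n.-tuple nat := [tuple e i | i < n].

Definition econs (x : nat) (e : nat -> nat) (i : nat) : nat :=
  if i is i'.+1 then e i' else x.

(* [F] is computed from the first [n] variables of its environment, for every large
   enough arity [n]. Environments make binders such as bounded sums and iterations
   compositional without any tuple manipulation. *)
Definition computable (F : (nat -> nat) -> nat) : Prop :=
  exists N, forall n, (N <= n)%N ->
    exists c : recf n, forall e r, reval c (env_tuple n e) r <-> r = F e.

Lemma tnth_env n e (i : 'I_n) : tnth (env_tuple n e) i = e i.
Proof. by rewrite tnth_mktuple. Qed.

Lemma behead_env n e : behead_tuple (env_tuple n.+1 e) = env_tuple n (fun i => e i.+1).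
Proof. by apply: eq_from_tnth => i; rewrite tnth_behead !tnth_env inordK // ltnS. Qed.

Lemma thead_env n e : thead (env_tuple n.+1 e) = e 0%N.
Proof. by rewrite /thead tnth_env. Qed.

Lemma cons_env n x e : cons_tuple x (env_tuple n e) = env_tuple n.+1 (econs x e).
Proof.
apply: eq_from_tnth => i; rewrite tnth_env.
case: (unliftP ord0 i) => [j ->|->]; last by rewrite tnth0.
by rewrite tnthS tnth_env.
Qed.

Lemma computable_ext F G : F =1 G -> computable F -> computable G.
Proof. by move=> /funext ->. Qed.

(** The program for [F] at one fixed arity [N] reads only [N] variables, so only finitely many
    programs for the [G i] are needed and their arities have a maximum. *)
Lemma computable_sub F (G : nat -> (nat -> nat) -> nat) :
  computable F -> (forall i, computable (G i)) ->
  computable (fun e => F (fun i => G i e)).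
Proof.
move=> [N /(_ N (leqnn N)) [c cP]] /choice[M MP].
exists (\max_(i < N) M i)%N => n le_n.
have /choice[g gP] (i : 'I_N) : exists d : recf n,
    forall e r, reval d (env_tuple n e) r <-> r = G i e.
  by apply: MP; apply: leq_trans le_n; apply: (leq_bigmax i).
exists (rcomp c g) => e r /=; split=> [[w wP]|->].
  have -> : w = env_tuple N (fun i => G i e).
    by apply: eq_from_tnth => i; rewrite tnth_env; apply/gP.
  by move/cP.
exists (env_tuple N (fun i => G i e)); last exact/cP.
by move=> i; rewrite tnth_env; apply/gP.
Qed.

Lemma computable_recursive n F : computable F ->
  recursive (fun v : n.-tuple nat => F (nth 0%N v)).
Proof.
move=> [N /(_ N (leqnn N)) [c cP]].
(* Variables beyond the arity [n] are fed with 0, the default of [nth]. *)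
exists (rcomp c (fun i : 'I_N =>
  if insub (i : nat) is Some j then rproj j else rzero n)) => v r /=.
have gP (i : 'I_N) s :
    reval (if insub (i : nat) is Some j then rproj j else rzero n) v s <->
    s = nth 0%N v i.
  case: insubP => [j _ <-|le_n] /=; first by rewrite (tnth_nth 0%N).
  by rewrite nth_default // size_tuple leqNgt.
split=> [[w wP]|->].
  have -> : w = env_tuple N (nth 0%N v).
    by apply: eq_from_tnth => i; rewrite tnth_env; apply/gP.
  by move/cP.
exists (env_tuple N (nth 0%N v)); last exact/cP.
by move=> i; rewrite tnth_env; apply/gP.
Qed.

Lemma recursive_computable n (F : n.-tuple nat -> nat) : recursive F ->
  computable (fun e => F (env_tuple n e)).
Proof.
move=> [c cP]; exists n => m le_nm.
exists (rcomp c (fun i => rproj (widen_ord le_nm i))) => e r /=; split=> [[w wP]|->].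
  have -> : w = env_tuple n e.
    by apply: eq_from_tnth => i; rewrite wP !tnth_env.
  by move/cP.
exists (env_tuple n e); last exact/cP.
by move=> i; rewrite !tnth_env.
Qed.

(** Unbounded search: [rmin] looks for a value of the fresh variable 0 at which the total test [T]
    vanishes, and halts exactly when one exists. *)
Lemma computable_re n (T : (nat -> nat) -> nat) : computable T ->
  re_rel (fun v : n.-tuple nat => exists y, T (econs y (nth 0%N v)) = 0%N).
Proof.
move=> /(@computable_recursive n.+1)[c cP]; exists (rmin c) => v.
have T_cons y : T (nth 0%N (cons_tuple y v)) = T (econs y (nth 0%N v)).
  by congr T; apply/funext => -[].
split=> [Ty|[r /= [/cP + _]]]; last by rewrite T_cons => Tr; exists r.
have exT : exists y, T (econs y (nth 0%N v)) == 0%N by case: Ty => y /eqP; exists y.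
case: (ex_minnP exT) => y /eqP Ty0 miny; exists y; split.
  by apply/cP; rewrite T_cons.
move=> z lt_zy; exists (T (econs z (nth 0%N v))).-1.
apply/cP; rewrite T_cons prednK // lt0n; apply/negP => /miny.
by rewrite leqNgt lt_zy.
Qed.

Lemma computable_var i : computable (fun e => e i).
Proof.
exists i.+1 => n lt_i; exists (rproj (Ordinal lt_i)) => e r /=.
by rewrite tnth_env.
Qed.

Lemma computable_succ F : computable F -> computable (fun e => (F e).+1).
Proof.
move=> cF; apply: (@computable_sub (fun e => (e 0%N).+1) (fun _ => F)) => //.
exists 1%N => n n1; exists (rcomp rsucc (fun=> rproj (Ordinal n1))) => e r /=.
split=> [[w wP ->]|->]; first by rewrite /thead wP tnth_env.
by exists [tuple e 0%N] => // i; rewrite tnth_env (ord1 i).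
Qed.

Lemma computable_const k : computable (fun=> k).
Proof.
elim: k => [|k IHk]; last exact: computable_succ.
by exists 0%N => n _; exists (rzero n) => e r.
Qed.

Lemma computable_prec (B F : (nat -> nat) -> nat) (S : nat -> nat -> (nat -> nat) -> nat) :
  computable B -> computable F ->
  computable (fun e => S (e 0%N) (e 1%N) (fun i => e i.+2)) ->
  computable (fun e => nat_rect (fun=> nat) (F e) (fun y s => S y s e) (B e)).
Proof.
move=> cB cF cS.
(* The recursion is first treated with variable 0 as its counter; [B] is substituted for that
   variable afterwards. *)
pose H e := nat_rect (fun=> nat) (F (fun i => e i.+1))
  (fun y s => S y s (fun i => e i.+1)) (e 0%N).
suff cH : computable H.
  apply: (@computable_ext (fun e => H (fun i => (if i is j.+1 then fun e => e j else B) e))).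
    by move=> e; rewrite /H.
  by apply: computable_sub => // -[//|i]; exact: computable_var.
case: cF => N NP; case: cS => M MP.
exists (maxn N M).+1 => -[//|n]; rewrite ltnS geq_max => /andP[leN leM].
have [c cP] := NP n leN.
have [d dP] := MP n.+2 (leq_trans leM (leqW (leqW (leqnn _)))).
exists (rprim c d) => e r /=; rewrite behead_env thead_env {}/H.
elim: (e 0%N) r => [|y IHy] r /=; first exact: cP.
split=> [[s /IHy -> ]|->].
  by rewrite !cons_env => /dP.
eexists; first exact/IHy.
by rewrite !cons_env; apply/dP.
Qed.

Lemma computable_iter (B F : (nat -> nat) -> nat) (S : nat -> (nat -> nat) -> nat) :
  computable B -> computable F ->
  computable (fun e => S (e 0%N) (fun i => e i.+1)) ->
  computable (fun e => iter (B e) (fun s => S s e) (F e)).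
Proof.
move=> cB cF cS.
apply: (@computable_ext (fun e =>
    nat_rect (fun=> nat) (F e) (fun y s => (fun _ s e => S s e) y s e) (B e))).
  by move=> e; elim: (B e) => //= k ->.
apply: computable_prec => //.
apply: (@computable_sub (fun e => S (e 0%N) (fun i => e i.+1)) (fun i e => e i.+1)) => //.
by move=> i; exact: computable_var.
Qed.

Lemma computable_add F G : computable F -> computable G ->
  computable (fun e => F e + G e)%N.
Proof.
move=> cF cG; apply: (@computable_ext (fun e => iter (F e) succn (G e))).
  by move=> e; rewrite iter_succn addnC.
apply: (@computable_iter F G (fun s _ => s.+1)) => //.
exact/computable_succ/computable_var.
Qed.

Lemma computable_pred F : computable F -> computable (fun e => (F e).-1).
Proof.
move=> cF; apply: (@computable_ext (fun e => nat_rect (fun=> nat) 0%N (fun y s => y) (F e))).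
  by move=> e; case: (F e).
by apply: (@computable_prec _ _ (fun y _ _ => y)) => //;
  [exact: computable_const | exact: computable_var].
Qed.

Lemma computable_subn F G : computable F -> computable G ->
  computable (fun e => F e - G e)%N.
Proof.
move=> cF cG; apply: (@computable_ext (fun e => iter (G e) predn (F e))).
  by move=> e; rewrite iter_predn.
apply: (@computable_iter _ _ (fun s _ => s.-1)) => //.
exact/computable_pred/computable_var.
Qed.

Lemma computable_sum B (F : nat -> (nat -> nat) -> nat) :
  computable B -> computable (fun e => F (e 0%N) (fun i => e i.+1)) ->
  computable (fun e => \sum_(0 <= i < B e) F i e)%N.
Proof.
move=> cB cF.
apply: (@computable_ext (fun e =>
    nat_rect (fun=> nat) 0%N (fun y s => s + F y e)%N (B e))).
  by move=> e; elim: (B e) => [|k IHk] /=; [rewrite big_geq | rewrite big_nat_recr //= -IHk].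
apply: (@computable_prec _ _ (fun y s e => s + F y e)%N) => //.
  exact: computable_const.
apply: computable_add; first exact: computable_var.
(* Here variable 0 is the index and variable 1 the accumulator, which [F] must not see. *)
apply: (@computable_sub (fun e => F (e 0%N) (fun i => e i.+1))
  (fun i e => if i is j.+1 then e j.+2 else e 0%N)) => //.
by case=> [|i]; exact: computable_var.
Qed.

Lemma computable_mul F G : computable F -> computable G ->
  computable (fun e => F e * G e)%N.
Proof.
move=> cF cG; apply: (@computable_ext (fun e => \sum_(0 <= i < F e) G e)%N).
  by move=> e; rewrite sum_nat_const_nat subn0.
apply: (@computable_sum F (fun _ => G)) => //.
apply: (@computable_sub G (fun i e => e i.+1)) => // i.
exact: computable_var.
Qed.

Lemma computable_exp F G : computable F -> computable G ->
  computable (fun e => F e ^ G e)%N.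
Proof.
move=> cF cG; apply: (@computable_ext (fun e => iter (G e) (fun s => F e * s)%N 1%N)).
  by move=> e; elim: (G e) => //= k ->; rewrite expnS.
apply: (@computable_iter _ _ (fun s e => F e * s)%N) => //.
  exact: computable_const.
apply: computable_mul; last exact: computable_var.
apply: (@computable_sub F (fun i e => e i.+1)) => // i.
exact: computable_var.
Qed.

Lemma computable_leq F G : computable F -> computable G ->
  computable (fun e => nat_of_bool (F e <= G e)%N).
Proof.
move=> cF cG; apply: (@computable_ext (fun e => 1 - (F e - G e))%N).
  by move=> e; rewrite /leq; case: (F e - G e)%N.
by apply: computable_subn; [exact: computable_const | exact: computable_subn].
Qed.

Lemma computable_andb (F G : _ -> bool) : computable F -> computable G ->
  computable (fun e => nat_of_bool (F e && G e)).
Proof.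
move=> cF cG; apply: (@computable_ext (fun e => F e * G e)%N).
  by move=> e; case: (F e); case: (G e).
exact: computable_mul.
Qed.

Lemma computable_negb (F : _ -> bool) : computable F ->
  computable (fun e => nat_of_bool (~~ F e)).
Proof.
move=> cF; apply: (@computable_ext (fun e => 1 - F e)%N).
  by move=> e; case: (F e).
by apply: computable_subn; [exact: computable_const | ].
Qed.

Lemma computable_orb (F G : _ -> bool) : computable F -> computable G ->
  computable (fun e => nat_of_bool (F e || G e)).
Proof.
move=> cF cG; apply: (@computable_ext (fun e => ~~ (~~ F e && ~~ G e))).
  by move=> e; case: (F e); case: (G e).
by do 2?[apply: computable_negb || apply: computable_andb];
  exact: computable_negb.
Qed.

Lemma computable_eqn F G : computable F -> computable G ->
  computable (fun e => nat_of_bool (F e == G e)).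
Proof.
move=> cF cG; apply: (@computable_ext (fun e => (F e <= G e)%N && (G e <= F e)%N)).
  by move=> e; rewrite eqn_leq.
by apply: computable_andb; exact: computable_leq.
Qed.

Lemma computable_has B (F : nat -> (nat -> nat) -> bool) :
  computable B -> computable (fun e => F (e 0%N) (fun i => e i.+1)) ->
  computable (fun e => nat_of_bool (has (fun i => F i e) (iota 0 (B e)))).
Proof.
move=> cB cF; apply: (@computable_ext (fun e => 1 <= \sum_(0 <= i < B e) F i e)%N).
  move=> e; rewrite /index_iota subn0; congr nat_of_bool.
  elim: (iota _ _) => [|i s IHs]; first by rewrite big_nil.
  by rewrite big_cons /= -IHs; case: (F i e).
by apply: computable_leq; [exact: computable_const|
  exact: (@computable_sum _ (fun i e => nat_of_bool (F i e)))].
Qed.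

Lemma computable_all B (F : nat -> (nat -> nat) -> bool) :
  computable B -> computable (fun e => F (e 0%N) (fun i => e i.+1)) ->
  computable (fun e => nat_of_bool (all (fun i => F i e) (iota 0 (B e)))).
Proof.
move=> cB cF; apply: (@computable_ext (fun e => ~~ has (fun i => ~~ F i e) (iota 0 (B e)))).
  by move=> e; rewrite -all_predC; congr nat_of_bool; apply: eq_all => i /=; rewrite negbK.
apply: computable_negb; apply: (@computable_has _ (fun i e => ~~ F i e)) => //.
exact: computable_negb.
Qed.

Lemma sum_ltn n q : (\sum_(0 <= i < n) (i < q) = minn n q)%N.
Proof.
elim: n => [|n IHn]; first by rewrite big_geq // min0n.
rewrite big_nat_recr //= IHn; case: ltnP => [lt_nq|le_qn].
  by rewrite addn1 (minn_idPl lt_nq).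
by rewrite addn0 (minn_idPr (leqW le_qn)).
Qed.

(** The quotient counts the positive multiples of the divisor up to the dividend. *)
Lemma computable_divn F G : computable F -> computable G -> (forall e, 0 < G e)%N ->
  computable (fun e => F e %/ G e)%N.
Proof.
move=> cF cG G_gt0.
apply: (@computable_ext (fun e => \sum_(0 <= i < F e) (i.+1 * G e <= F e)%N)%N).
  move=> e; under eq_bigr do rewrite -leq_divRL //.
  by rewrite sum_ltn (minn_idPr (leq_div _ _)).
have shift H : computable H -> computable (fun e => H (fun i => e i.+1)).
  by move=> cH; apply: (@computable_sub H (fun i e => e i.+1)) => // i; exact: computable_var.
apply: (@computable_sum _ (fun i e => (i.+1 * G e <= F e)%N)) => //.
apply: computable_leq (shift _ cF).
apply: computable_mul (shift _ cG).
exact/computable_succ/computable_var.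
Qed.

Lemma computable_odd F : computable F -> computable (fun e => nat_of_bool (odd (F e))).
Proof.
move=> cF; apply: (@computable_ext (fun e => F e - (F e %/ 2) * 2)%N).
  by move=> e; rewrite {1}(divn_eq (F e) 2) addKn modn2.
apply: computable_subn => //; apply: computable_mul; last exact: computable_const.
by apply: computable_divn => //; exact: computable_const.
Qed.

Lemma computable_app1 (f : nat -> nat) F : computable (fun e => f (e 0%N)) ->
  computable F -> computable (fun e => f (F e)).
Proof.
by move=> cf cF; apply: (@computable_sub (fun e => f (e 0%N)) (fun=> F)).
Qed.

Lemma computable_app2 (f : nat -> nat -> nat) F G :
  computable (fun e => f (e 0%N) (e 1%N)) ->
  computable F -> computable G -> computable (fun e => f (F e) (G e)).
Proof.
move=> cf cF cG; apply: (@computable_sub (fun e => f (e 0%N) (e 1%N))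
  (fun i => if i is _.+1 then G else F)) => //.
by case.
Qed.

(** Syntax-directed: functions with a hypothesis in the context are treated before the arithmetic
    operations; positivity of divisors is left as a goal. *)
Ltac computability :=
  repeat (cbv beta; lazymatch goal with
  | |- computable (fun=> ?k) => apply: computable_const
  | |- computable (fun e => e _) => apply: computable_var
  | H : computable (fun e => ?f (e 0%N)) |- computable (fun e => ?f (@?F e)) =>
      refine (@computable_app1 f F H _)
  | H : computable (fun e => ?f (e 0%N) (e 1%N)) |-
      computable (fun e => ?f (@?F e) (@?G e)) =>
      refine (@computable_app2 f F G H _ _)
  | H : computable (fun e => nat_of_bool (?f (e 0%N))) |-
      computable (fun e => nat_of_bool (?f (@?F e))) =>
      refine (@computable_app1 (fun x => nat_of_bool (f x)) F H _)
  | H : computable (fun e => nat_of_bool (?f (e 0%N) (e 1%N))) |-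
      computable (fun e => nat_of_bool (?f (@?F e) (@?G e))) =>
      refine (@computable_app2 (fun x y => nat_of_bool (f x y)) F G H _ _)
  | |- computable (fun e => nat_of_bool (@?F e <= @?G e)%N) => refine (@computable_leq F G _ _)
  | |- computable (fun e => nat_of_bool (@?F e == @?G e)) => refine (@computable_eqn F G _ _)
  | |- computable (fun e => nat_of_bool (@?F e && @?G e)) => refine (@computable_andb F G _ _)
  | |- computable (fun e => nat_of_bool (@?F e || @?G e)) => refine (@computable_orb F G _ _)
  | |- computable (fun e => nat_of_bool (~~ @?F e)) => refine (@computable_negb F _)
  | |- computable (fun e => nat_of_bool (odd (@?F e))) => refine (@computable_odd F _)
  | |- computable (fun e => nat_of_bool (has (fun i => @?F e i) (iota 0 (@?B e)))) =>
      refine (@computable_has B (fun i e => F e i) _ _)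
  | |- computable (fun e => nat_of_bool (all (fun i => @?F e i) (iota 0 (@?B e)))) =>
      refine (@computable_all B (fun i e => F e i) _ _)
  | |- computable (fun e => (@?F e + @?G e)%N) => refine (@computable_add F G _ _)
  | |- computable (fun e => (@?F e - @?G e)%N) => refine (@computable_subn F G _ _)
  | |- computable (fun e => (@?F e * @?G e)%N) => refine (@computable_mul F G _ _)
  | |- computable (fun e => (@?F e ^ @?G e)%N) => refine (@computable_exp F G _ _)
  | |- computable (fun e => (@?F e %/ @?G e)%N) => refine (@computable_divn F G _ _ _)
  | |- computable (fun e => (@?F e).-1) => refine (@computable_pred F _)
  | |- computable (fun e => (@?F e).+1) => refine (@computable_succ F _)
  | |- computable (fun e => bigop 0%N (index_iota 0 (@?B e))
          (fun i => BigBody i addn true (@?F e i))) =>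
      refine (@computable_sum B (fun i e => F e i) _ _)
  | |- computable (fun e => iter (@?B e) (fun s => @?S e s) (@?F e)) =>
      refine (@computable_iter B F (fun s e => S e s) _ _ _)
  | |- computable (fun e => iter (@?B e) ?f (@?F e)) =>
      refine (@computable_iter B F (fun s _ => f s) _ _ _)
  end).

(** * Head and tail of a coded sequence *)

Lemma code_gt0 x s : (0 < CodeSeq.code (x :: s))%N.
Proof. by rewrite /= muln_gt0 expn_gt0. Qed.

(* [CodeSeq.code (x :: s) = 2 ^ x * (CodeSeq.code s).*2.+1], so the head is the
   2-adic valuation. *)
Definition code_head c := (\sum_(0 <= i < c) ((c %/ 2 ^ i.+1) * 2 ^ i.+1 == c))%N.
Definition code_tail c := (c %/ 2 ^ (code_head c).+1)%N.

Lemma code_headE x s : code_head (CodeSeq.code (x :: s)) = x.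
Proof.
rewrite /code_head; set c := CodeSeq.code _.
have cE : c = (2 ^ x * (CodeSeq.code s).*2.+1)%N by [].
have lt_xc : (x < c)%N.
  by rewrite cE (leq_trans (ltn_expl x (leqnn 2))) // leq_pmulr.
(* As [x < c], it suffices that [2 ^ i.+1] divides [c] exactly for [i < x]; the cofactor of [2 ^ x]
   is odd. *)
rewrite -[RHS](minn_idPr (ltnW lt_xc)) -sum_ltn; apply: eq_bigr => i _; congr nat_of_bool.
rewrite -dvdn_eq; apply/idP/idP => [|lt_ix].
  apply: contraTT; rewrite -leqNgt => le_xi; apply/negP => dvd_ic.
  have : (2 ^ x.+1 %| c)%N by apply: dvdn_trans dvd_ic; rewrite dvdn_exp2l.
  by rewrite cE expnSr dvdn_pmul2l ?expn_gt0 // dvdn2 /= odd_double.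
by rewrite cE dvdn_mulr // dvdn_exp2l.
Qed.

Lemma code_tailE x s : code_tail (CodeSeq.code (x :: s)) = CodeSeq.code s.
Proof.
rewrite /code_tail code_headE /= expnSr divnMl ?expn_gt0 //.
by rewrite divn2 /= uphalf_double.
Qed.

Lemma iter_code_tail k s : iter k code_tail (CodeSeq.code s) = CodeSeq.code (drop k s).
Proof.
elim: k s => [|k IHk] s; first by rewrite drop0.
case: s => [|x s]; last by rewrite iterSr code_tailE IHk.
(* The empty sequence has code 0, which the tail fixes, so iterating past the end is harmless. *)
have tail0 : code_tail (CodeSeq.code [::]) = CodeSeq.code [::] by rewrite /code_tail div0n.
by rewrite iterSr tail0 IHk.
Qed.

Lemma computable_code_head : computable (fun e => code_head (e 0%N)).
Proof. by rewrite /code_head; computability; move=> e; rewrite expn_gt0. Qed.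

Lemma computable_code_tail : computable (fun e => code_tail (e 0%N)).
Proof.
have cH := computable_code_head.
by rewrite /code_tail; computability; move=> e; rewrite expn_gt0.
Qed.

(** * Coin tossing *)

Section CoinTossing.
Context (R : realFieldType).
Implicit Types (p q : R) (f g : seq bool -> R).

(** Expectation of [f] over [d] independent tosses showing [true] with probability [p], by
    conditioning on the first toss. *)
Fixpoint bexp p (d : nat) f : R :=
  if d is d'.+1 then
    p * bexp p d' (fun s => f (true :: s)) + (1 - p) * bexp p d' (fun s => f (false :: s))
  else f [::].

Definition dev p (s : seq bool) : R := (count id s)%:R - p * (size s)%:R.

Lemma dev_cons p b s : dev p (b :: s) = b%:R - p + dev p s.
Proof. by rewrite /dev /= natrD -natr1; ring. Qed.

Lemma dev_cat p s1 s2 : dev p (s1 ++ s2) = dev p s1 + dev p s2.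
Proof. by rewrite /dev count_cat size_cat !natrD; ring. Qed.

Lemma eq_bexp p d f g : (forall s, size s = d -> f s = g s) -> bexp p d f = bexp p d g.
Proof.
elim: d f g => [|d IHd] f g fg /=; first exact: fg.
by congr (_ * _ + _ * _); apply: IHd => s sd; apply: fg; rewrite /= sd.
Qed.

Lemma le_bexp p d f g : 0 <= p <= 1 ->
  (forall s, size s = d -> f s <= g s) -> bexp p d f <= bexp p d g.
Proof.
move=> /andP[p0 p1]; elim: d f g => [|d IHd] f g fg /=; first exact: fg.
by apply: lerD; apply: ler_wpM2l; rewrite ?subr_ge0 //; apply: IHd => s sd;
  apply: fg; rewrite /= sd.
Qed.

Lemma bexpD p d f g : bexp p d (fun s => f s + g s) = bexp p d f + bexp p d g.
Proof. by elim: d f g => [//|d IHd] f g /=; rewrite !IHd; ring. Qed.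

Lemma bexpZ p d c f : bexp p d (fun s => c * f s) = c * bexp p d f.
Proof. by elim: d f => [//|d IHd] f /=; rewrite !IHd; ring. Qed.

Lemma bexp_cst p d c : bexp p d (fun=> c) = c.
Proof. by elim: d => [//|d IHd] /=; rewrite !IHd; ring. Qed.

Lemma bexp_ge0 p d f : 0 <= p <= 1 -> (forall s, 0 <= f s) -> 0 <= bexp p d f.
Proof. by move=> p01 f0; rewrite -(bexp_cst p d 0); apply: le_bexp. Qed.

Lemma bexp_le1 p d f : 0 <= p <= 1 -> (forall s, f s <= 1) -> bexp p d f <= 1.
Proof. by move=> p01 f1; rewrite -[leRHS](bexp_cst p d 1); apply: le_bexp. Qed.

(** Independence of the first [m] tosses from the last [n]. *)
Lemma bexp_prod p m n f g :
  bexp p (m + n) (fun s => f (take m s) * g (drop m s)) = bexp p m f * bexp p n g.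
Proof.
elim: m f => [|m IHm] f /=.
  by rewrite -bexpZ; apply: eq_bexp => s _; rewrite take0 drop0.
by rewrite !(IHm (fun s => f (_ :: s))); ring.
Qed.

Lemma bexp_take p m n f : bexp p (m + n) (fun s => f (take m s)) = bexp p m f.
Proof.
rewrite -[RHS]mulr1 -[in RHS](bexp_cst p n 1) -bexp_prod.
by apply: eq_bexp => s _; rewrite mulr1.
Qed.

(** Changing the bias of a single toss moves the expectation of a function with values in [0, 1] by
    at most [|p - q|]; the tosses are changed one at a time. *)
Lemma bexp_perturb p q d f : 0 <= p <= 1 -> 0 <= q <= 1 ->
  (forall s, 0 <= f s <= 1) -> `|bexp p d f - bexp q d f| <= d%:R * `|p - q|.
Proof.
move=> p01 q01; have /andP[q0 q1] := q01.
elim: d f => [|d IHd] f f01 /=; first by rewrite subrr normr0 mul0r.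
set ft := fun s => f (true :: s); set ff := fun s => f (false :: s).
have -> : p * bexp p d ft + (1 - p) * bexp p d ff -
          (q * bexp q d ft + (1 - q) * bexp q d ff) =
   (p - q) * (bexp p d ft - bexp p d ff) +
   (q * (bexp p d ft - bexp q d ft) + (1 - q) * (bexp p d ff - bexp q d ff)) by ring.
rewrite -natr1 [leRHS]mulrDl mul1r [leRHS]addrC; apply: le_trans (ler_normD _ _) _.
apply: lerD; last first.
  apply: le_trans (ler_normD _ _) _; rewrite !normrM (ger0_norm q0).
  rewrite (@ger0_norm _ (1 - q)) ?subr_ge0 //.
  have -> : d%:R * `|p - q| = q * (d%:R * `|p - q|) + (1 - q) * (d%:R * `|p - q|) by ring.
  by apply: lerD; apply: ler_wpM2l; rewrite ?subr_ge0 //; apply: IHd => s; apply: f01.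
rewrite normrM ler_piMr //.
have f_bd g (g01 : forall s, 0 <= g s <= 1) : 0 <= bexp p d g <= 1.
  by rewrite bexp_ge0 ?bexp_le1 // => s; case/andP: (g01 s).
have /andP[t0 t1] := f_bd ft (fun s => f01 _).
have /andP[f0 f1] := f_bd ff (fun s => f01 _).
by rewrite ler_norml; lra.
Qed.

(** A crossing by the walk started at [y] counts at every prefix, the empty one included; the
    explicit start fits induction on the first toss. *)
Fixpoint exceeds p (x y : R) (s : seq bool) : bool :=
  (x <= `|y|) || (if s is b :: s' then exceeds p x (y + b%:R - p) s' else false).

Lemma exceeds_take p x y s k : (k <= size s)%N ->
  x <= `|y + dev p (take k s)| -> exceeds p x y s.
Proof.
elim: k s y => [|k IHk] s y.
  by rewrite take0 /dev /= mulr0 subrr addr0; case: s => [|b s] _ /= ->.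
case: s => [//|b s] /= ks; rewrite dev_cons => xy; apply/orP; right.
by apply: IHk => //; rewrite -[y + _ - p]addrA -addrA.
Qed.

(* [((y + dev)^2 + (d - k) p (1 - p)) / x^2] is a nonnegative martingale. *)
Lemma bexp_kolmogorov p d (x y : R) : 0 <= p <= 1 -> 0 < x ->
  bexp p d (fun s => (exceeds p x y s)%:R) <= (y ^+ 2 + d%:R * (p * (1 - p))) / x ^+ 2.
Proof.
move=> p01 x0; have /andP[p0 p1] := p01.
have q0 : 0 <= p * (1 - p) by rewrite mulr_ge0 ?subr_ge0.
elim: d y => [|d IHd] y.
  rewrite /= orbF mul0r addr0; case: (leP x `|y|) => [xy|_]; last by rewrite divr_ge0 ?sqr_ge0.
  by rewrite ler_pdivlMr ?exprn_gt0 // mul1r -[leRHS]real_normK ?num_real // ler_sqr // nnegrE ltW.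
(* Past the threshold the right side is already at least 1. *)
have [xy|yx] := leP x `|y|.
  apply: (@le_trans _ _ 1); first by apply: bexp_le1 => // s; rewrite lern1 leq_b1.
  rewrite ler_pdivlMr ?exprn_gt0 // mul1r.
  apply: (@le_trans _ _ (y ^+ 2)); last by rewrite lerDl mulr_ge0.
  by rewrite -[leRHS]real_normK ?num_real // ler_sqr // nnegrE ltW.
rewrite /= (lt_geF yx) /=.
apply: (@le_trans _ _ (p * (((y + 1 - p) ^+ 2 + d%:R * (p * (1 - p))) / x ^+ 2) +
    (1 - p) * (((y + 0 - p) ^+ 2 + d%:R * (p * (1 - p))) / x ^+ 2))).
  by apply: lerD; apply: ler_wpM2l; rewrite ?subr_ge0 //; apply: IHd.
rewrite -natr1 le_eqVlt; apply/orP; left; apply/eqP; field.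
by rewrite gt_eqF.
Qed.

Lemma bexp_dev_sqr p d : bexp p d (fun s => dev p s ^+ 2) = d%:R * (p * (1 - p)).
Proof.
(* The start [y] is generalized because the first toss shifts it. *)
suff H y : bexp p d (fun s => (y + dev p s) ^+ 2) = y ^+ 2 + d%:R * (p * (1 - p)).
  have /esym := H 0; rewrite expr0n add0r => ->.
  by apply: eq_bexp => s _; rewrite add0r.
elim: d y => [|d IHd] y; first by rewrite /= /dev /= mulr0 subrr; ring.
have step b : bexp p d (fun s => (y + dev p (b :: s)) ^+ 2) =
    (y + (b%:R - p)) ^+ 2 + d%:R * (p * (1 - p)).
  by rewrite -IHd; apply: eq_bexp => s _; rewrite dev_cons addrA.
by rewrite /= !step -natr1 /=; ring.
Qed.

Lemma bexp_chebyshev p d (x : R) : 0 <= p <= 1 -> 0 < x ->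
  bexp p d (fun s => (x <= `|dev p s|)%R%:R) <= d%:R * (p * (1 - p)) / x ^+ 2.
Proof.
move=> p01 x0; rewrite mulrC -bexp_dev_sqr -bexpZ; apply: le_bexp => // s _.
rewrite mulrC; case: (leP x `|dev p s|) => [xy|_]; last by rewrite divr_ge0 ?sqr_ge0.
by rewrite ler_pdivlMr ?exprn_gt0 // mul1r -[leRHS]real_normK ?num_real // ler_sqr // nnegrE ltW.
Qed.

(** * Likelihood ratios and change of measure *)

Definition lratio p q (s : seq bool) : R :=
  \prod_(b <- s) (if b then q / p else (1 - q) / (1 - p)).

Lemma bexp_lratio p q d f : p != 0 -> p != 1 ->
  bexp p d (fun s => lratio p q s * f s) = bexp q d f.
Proof.
move=> p0 p1; elim: d f => [|d IHd] f /=; first by rewrite /lratio big_nil mul1r.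
have step b : bexp p d (fun s => lratio p q (b :: s) * f (b :: s)) =
    (if b then q / p else (1 - q) / (1 - p)) * bexp q d (fun s => f (b :: s)).
  by rewrite -IHd -bexpZ; apply: eq_bexp => s _; rewrite /lratio big_cons mulrA.
by rewrite !step; field; rewrite p0 subr_eq0 eq_sym p1.
Qed.

(** The second moment multiplies over the tosses, and a single toss contributes [q^2 / p + (1 - q)^2
    / (1 - p) = 1 + (q - p)^2 / (p (1 - p))]. *)
Lemma bexp_lratio_sqr p q d : p != 0 -> p != 1 ->
  bexp p d (fun s => lratio p q s ^+ 2) = (1 + (q - p) ^+ 2 / (p * (1 - p))) ^+ d.
Proof.
move=> p0 p1; elim: d => [|d IHd] /=; first by rewrite /lratio big_nil expr1n.
have step b : bexp p d (fun s => lratio p q (b :: s) ^+ 2) =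
    (if b then q / p else (1 - q) / (1 - p)) ^+ 2 * (1 + (q - p) ^+ 2 / (p * (1 - p))) ^+ d.
  by rewrite -IHd -bexpZ; apply: eq_bexp => s _; rewrite /lratio big_cons exprMn.
rewrite !step [RHS]exprS; move: (_ ^+ d) => u; field.
by rewrite p0 subr_eq0 eq_sym p1.
Qed.

(* Cauchy-Schwarz for the change of measure from [p] to [q], in the linear form
   [L 1_A <= K 1_A + L^2 / (4 K)]. *)
Lemma bexp_change p q d (A : pred (seq bool)) K : 0 < p < 1 -> 0 < K ->
  (1 + (q - p) ^+ 2 / (p * (1 - p))) ^+ d <= K ->
  bexp q d (fun s => (A s)%:R) <= K * bexp p d (fun s => (A s)%:R) + 4^-1.
Proof.
move=> /andP[p0 p1] K0 leK.
have p01 : 0 <= p <= 1 by rewrite !ltW.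
rewrite -(@bexp_lratio p) ?(gt_eqF p0) ?(lt_eqF p1) //.
apply: (@le_trans _ _ (bexp p d (fun s => K * (A s)%:R + (4 * K)^-1 * lratio p q s ^+ 2))).
  apply: le_bexp => // s _; move: (lratio p q s) => L.
  have : 0 <= (4 * K)^-1 * (L - 2 * K) ^+ 2.
    by rewrite mulr_ge0 ?sqr_ge0 // invr_ge0 mulr_ge0 // ltW.
  have -> : (4 * K)^-1 * (L - 2 * K) ^+ 2 = (4 * K)^-1 * L ^+ 2 - L + K.
    by field; rewrite gt_eqF.
  case: (A s) => /= h; first lra.
  by rewrite !mulr0 add0r mulr_ge0 ?sqr_ge0 // invr_ge0 mulr_ge0 // ltW.
rewrite bexpD !bexpZ bexp_lratio_sqr ?(gt_eqF p0) ?(lt_eqF p1) //; apply: lerD => //.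
by rewrite mulrC ler_pdivrMr ?mulr_gt0 // mulrA mulVf ?mul1r.
Qed.

End CoinTossing.

(** * Events determined by the positions of a letter *)

Lemma bigcup_finType_measure d (T : measurableType d) (R : realType)
    (mu : {measure set T -> \bar R}) (I : finType) (F : I -> set T) :
  (forall i, measurable (F i)) -> trivIset setT F ->
  mu (\bigcup_i F i) = (\sum_(i : I) mu (F i))%E.
Proof.
move=> mF tF; rewrite measure_fin_bigcup //; last exact: finite_finset.
have -> : [set: I] = [set` enum I] by apply/seteqP; split=> i //= _; rewrite mem_enum.
by rewrite -fsbig_seq ?enum_uniq // big_enum.
Qed.

Lemma nondecreasing_measure_le d (T : measurableType d) (R : realType)
    (mu : {measure set T -> \bar R}) (F : nat -> set T) (x : \bar R) :
  (forall i, measurable (F i)) -> nondecreasing_seq F ->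
  (forall i, (mu (F i) <= x)%E) -> (mu (\bigcup_i F i) <= x)%E.
Proof.
move=> mF ndF leF; have cF := @nondecreasing_cvg_mu _ _ _ mu _ mF (bigcupT_measurable _ mF) ndF.
rewrite -(cvg_lim (@ereal_hausdorff R) cF); apply: lime_le.
  by apply/cvg_ex; eexists; exact: cF.
by near=> n; exact: leF.
Unshelve. all: by end_near.
Qed.

Section LetterEvents.
Context (R : realType) (Omega : alphabetType) (P : Omega -> R).
Context (hP : finite_probability P).
Context (mu : probability (infseq Omega) R).
Context (mu_bernoulli : bernoulli_measure P mu).
Context (a : Omega).

Definition letter_bits (s : seq Omega) : seq bool := [seq x == a | x <- s].

Lemma letter_bits_rcons w x : letter_bits (rcons w x) = rcons (letter_bits w) (x == a).
Proof. exact: map_rcons. Qed.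

Definition letter_event (L : nat) (Q : pred (seq bool)) : set (infseq Omega) :=
  [set alpha : nat -> Omega | Q (letter_bits (mkseq alpha L))].

Lemma letter_prob01 : 0 <= P a <= 1.
Proof.
case: hP => P0 <-; rewrite P0 (bigD1 a) //= lerDl.
by apply: sumr_ge0 => b _; exact: P0.
Qed.

Lemma measurable_cylinder (S : set (seq Omega)) :
  measurable (cylinder S : set (infseq Omega)).
Proof. by apply: sub_sigma_algebra; exists S. Qed.

Lemma cylinder1E (w : seq Omega) :
  cylinder [set w] = [set alpha | mkseq alpha (size w) = w].
Proof.
apply/seteqP; split=> alpha /= => [[n <-]|aw]; first by rewrite size_mkseq.
by exists (size w).
Qed.

(** Fixing a prefix [w] and leaving [d] letters free allows induction on [d], each step splitting on
    the next letter. *)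
Let prefix_event (w : seq Omega) d (Q : pred (seq bool)) : set (infseq Omega) :=
  [set alpha : nat -> Omega | mkseq alpha (size w) = w /\
     Q (letter_bits (mkseq alpha (size w + d)))].

Let prefix_event_rcons w d Q :
  prefix_event w d.+1 Q = \bigcup_(x : Omega) prefix_event (rcons w x) d Q.
Proof.
apply/seteqP; split=> alpha /=.
  move=> [aw Qa]; exists (alpha (size w)) => //.
  by rewrite /prefix_event /= size_rcons mkseqS aw addSnnS.
move=> [x _ /= []]; rewrite size_rcons mkseqS => /eqP.
by rewrite eqseq_rcons addSnnS => /andP[/eqP aw _].
Qed.

(** Every letter other than [a] appends the same bit [false], and these letters have total
    probability [1 - P a]; this reproduces the recursion of [bexp]. *)
Let measure_prefix_event w d Q :
  measurable (prefix_event w d Q) /\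
  mu (prefix_event w d Q) =
    (\prod_(x <- w) P x * bexp (P a) d (fun u => (Q (letter_bits w ++ u))%:R))%:E.
Proof.
elim: d w => [|d IHd] w.
  have [Qw|nQw] := boolP (Q (letter_bits w)).
    have -> : prefix_event w 0 Q = cylinder [set w].
      rewrite cylinder1E; apply/seteqP; split=> alpha /= => [[]//|aw].
      by split=> //=; rewrite addn0 aw.
    split; first exact: measurable_cylinder.
    by rewrite mu_bernoulli /= cats0 Qw mulr1.
  have -> : prefix_event w 0 Q = set0.
    apply/seteqP; split=> alpha //= [aw]; rewrite addn0 aw.
    by rewrite (negbTE nQw).
  by split; [exact: measurable0 | rewrite measure0 /= cats0 (negbTE nQw) mulr0].
rewrite prefix_event_rcons; split.
  by apply: fin_bigcup_measurable => // x _; case: (IHd (rcons w x)).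
rewrite bigcup_finType_measure; last 2 first.
- by move=> x; case: (IHd (rcons w x)).
- apply/trivIsetP => x y _ _; apply: contra_neqP => /eqP/set0P[alpha /=].
  move=> [[+ _] [+ _]]; rewrite !size_rcons !mkseqS => /eqP + /eqP.
  by rewrite !eqseq_rcons => /andP[_ /eqP<-] /andP[_ /eqP<-].
rewrite (eq_bigr (fun x => (\prod_(y <- rcons w x) P y *
    bexp (P a) d (fun u => (Q (letter_bits (rcons w x) ++ u))%:R))%:E)); last first.
  by move=> x _; exact: (IHd (rcons w x)).2.
under eq_bigr do rewrite big_rcons /=.
rewrite sumEFin; congr EFin.
have step b : bexp (P a) d (fun u => (Q (letter_bits w ++ b :: u))%:R) =
   bexp (P a) d (fun u => (Q (rcons (letter_bits w) b ++ u))%:R) :> R.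
  by apply: eq_bexp => u _; rewrite cat_rcons.
rewrite [X in _ = _ * X]/= !step (bigD1 a) //=.
under [X in _ + X = _]eq_bigr => x xa do rewrite letter_bits_rcons (negbTE xa) mulrAC.
rewrite -mulr_sumr.
have -> : \sum_(x | x != a) P x = 1 - P a.
  by have [_] := hP; rewrite (bigD1 a) //= => <-; ring.
by rewrite letter_bits_rcons eqxx; ring.
Qed.

Lemma measurable_letter_event L Q : measurable (letter_event L Q).
Proof.
have [+ _] := measure_prefix_event [::] L Q.
by congr measurable; apply/seteqP; split=> alpha /= => [[]|].
Qed.

Lemma measure_letter_event L Q :
  mu (letter_event L Q) = (bexp (P a) L (fun u => (Q u)%:R))%:E.
Proof.
have [_] := measure_prefix_event [::] L Q; rewrite big_nil mul1r => <-.
by congr (mu _); apply/seteqP; split=> alpha /= => [|[]].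
Qed.

End LetterEvents.

(** * Bit strings and string codes *)

(** Least significant bit first, cut or padded to length [L]; bit strings thus become numbers on
    which recursive functions operate. *)
Definition bits (n L : nat) : seq bool := mkseq (fun i => odd (n %/ 2 ^ i)) L.

Definition bits_num (s : seq bool) : nat := foldr (fun (b : bool) n => b + n.*2)%N 0%N s.

Lemma size_bits n L : size (bits n L) = L.
Proof. exact: size_mkseq. Qed.

Lemma take_bits n k L : (k <= L)%N -> take k (bits n L) = bits n k.
Proof. by move=> kL; rewrite /bits /mkseq -map_take take_iota (minn_idPl kL). Qed.

Lemma bits_cons (b : bool) n L : bits (b + n.*2) L.+1 = b :: bits n L.
Proof.
rewrite /bits /mkseq /= expn0 divn1 oddD odd_double addbF oddb; congr cons.
rewrite -[1%N]add1n iotaDl -map_comp; apply: eq_map => i /=.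
by rewrite add1n expnS divnMA divn2 half_bit_double.
Qed.

Lemma bits_numK s : bits (bits_num s) (size s) = s.
Proof. by elim: s => //= b s IHs; rewrite bits_cons IHs. Qed.

Lemma bits_numE s : bits_num s = (\sum_(0 <= i < size s) nth false s i * 2 ^ i)%N.
Proof.
elim: s => [|b s IHs]; first by rewrite big_geq.
rewrite /= big_nat_recl //= expn0 muln1 IHs -muln2 big_distrl /=.
by congr addn; apply: eq_bigr => i _; rewrite expnSr mulnA.
Qed.

Lemma count_bits n k : count id (bits n k) = (\sum_(0 <= i < k) odd (n %/ 2 ^ i))%N.
Proof.
rewrite -sumn_count sumnE big_map /index_iota subn0 big_map.
by [].
Qed.

Lemma big_nat_double (V : nmodType) n (F : nat -> V) :
  \sum_(0 <= i < n.*2) F i = \sum_(0 <= i < n) (F i.*2 + F (1 + i.*2)%N).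
Proof.
elim: n => [|n IHn]; first by rewrite !big_geq.
by rewrite doubleS !big_nat_recr //= IHn add1n addrA.
Qed.

(** The strings of length [L] are enumerated as numbers below [2 ^ L]; one with [h] ones has weight
    [A^h (D - A)^(L - h) / D^L]. For an indicator this leaves a quotient of two natural numbers that
    can be computed. *)
Lemma bexp_dyadic (R : realFieldType) (A D L : nat) (f : seq bool -> R) :
  (0 < D)%N -> (A <= D)%N ->
  bexp (A%:R / D%:R) L f = (\sum_(0 <= n < 2 ^ L) f (bits n L) *
     (A ^ count id (bits n L) * (D - A) ^ (L - count id (bits n L)))%:R) / D%:R ^+ L.
Proof.
move=> D0 AD; have Dn0 : D%:R != 0 :> R by rewrite pnatr_eq0 -lt0n.
elim: L f => [|L IHL] f.
  by rewrite expn0 big_nat1 /= expr0 divr1 mulr1.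
have Dn : D%:R ^+ L != 0 :> R by rewrite expf_neq0.
have step (b : bool) : \sum_(0 <= n < 2 ^ L) f (bits (b + n.*2) L.+1) *
      (A ^ count id (bits (b + n.*2) L.+1) *
       (D - A) ^ (L.+1 - count id (bits (b + n.*2) L.+1)))%:R =
    (if b then A%:R else D%:R - A%:R) *
    (bexp (A%:R / D%:R) L (fun s => f (b :: s)) * D%:R ^+ L).
  rewrite IHL mulfVK // mulr_sumr; apply: eq_bigr => n _.
  rewrite bits_cons mulrCA; congr (_ * _); rewrite -natrB //.
  have cL : (count id (bits n L) <= L)%N by rewrite -[leqRHS](size_bits n) count_size.
  case: b; rewrite [count id _]/=; first by rewrite add1n subSS expnS -mulnA natrM.
  by rewrite add0n subSn // expnS mulnCA natrM.
(* Even and odd numbers correspond to the two outcomes of the first toss. *)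
rewrite expnS mul2n big_nat_double big_split /= (step false) (step true) exprS.
by field; rewrite Dn0 Dn.
Qed.

(** The numerator is the rational approximation times [2 ^ m], rounded down and clipped to [2 ^ m];
    approximation and rounding contribute at most 1 each to the error. *)
Lemma computable_real_dyadic (R : realType) (x : R) : 0 <= x <= 1 -> computable_real x ->
  exists A : nat -> nat, [/\ computable (fun e => A (e 0%N)),
    forall m, (A m <= 2 ^ m)%N & forall m, `|(A m)%:R - x * 2 ^+ m| <= 2].
Proof.
move=> /andP[x0 x1] [f [p [q [d [+ + + fE]]]] xf].
move=> /recursive_computable cp /recursive_computable cq /recursive_computable cd.
pose t m : 1.-tuple nat := env_tuple 1 (fun=> m).
have {}cp : computable (fun e => p (t (e 0%N))).
  by apply: computable_ext cp => e; congr p; apply: eq_from_tnth => i; rewrite !tnth_env (ord1 i).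
have {}cq : computable (fun e => q (t (e 0%N))).
  by apply: computable_ext cq => e; congr q; apply: eq_from_tnth => i; rewrite !tnth_env (ord1 i).
have {}cd : computable (fun e => d (t (e 0%N))).
  by apply: computable_ext cd => e; congr d; apply: eq_from_tnth => i; rewrite !tnth_env (ord1 i).
(* Truncated subtraction replaces a negative approximation by 0, which is closer to [x >= 0]. *)
pose N m := (((p (t m) - q (t m)) * 2 ^ m) %/ (d (t m)).+1)%N.
exists (fun m => minn (2 ^ m) (N m)); split.
- apply: (@computable_ext (fun e => 2 ^ e 0%N - (2 ^ e 0%N - N (e 0%N)))%N) => [e|].
    by rewrite minnE.
  rewrite /N.
  computability; try done.
- by move=> m; rewrite geq_minl.
move=> m; have m0 : 0 < 2 ^+ m :> R by rewrite exprn_gt0.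
have := xf m; have := fE (t m); rewrite tnth_env => ->.
rewrite fmorph_div rmorphB /= !ratr_nat.
set u := p _; set v := q _; set w := (d _).+1 => xm.
have w0 : 0 < w%:R :> R by rewrite ltr0n.
have yP : `|(u - v)%N%:R / w%:R * 2 ^+ m - x * 2 ^+ m| <= 1.
  rewrite -mulrBl normrM (gtr0_norm m0) -ler_pdivlMr // mul1r.
  apply: le_trans (ltW xm); rewrite distrC.
  have [vu|/ltnW uv] := leqP v u; first by rewrite natrB.
  move: (uv); rewrite -subn_eq0 => /eqP->; rewrite mul0r subr0 (ger0_norm x0).
  rewrite ler_normr; apply/orP; left; rewrite lerDl oppr_ge0 pmulr_lle0 ?invr_gt0 //.
  by rewrite subr_le0 ler_nat.
have N1 : (N m)%:R <= (u - v)%N%:R / w%:R * 2 ^+ m :> R.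
  rewrite mulrAC ler_pdivlMr // -natrX -!natrM ler_nat.
  by rewrite -leq_divRL.
have N2 : (u - v)%N%:R / w%:R * 2 ^+ m < (N m)%:R + 1 :> R.
  rewrite mulrAC ltr_pdivrMr // natr1 -natrX -!natrM ltr_nat.
  by rewrite -ltn_divLR.
have x2 : x * 2 ^+ m <= 2 ^+ m by rewrite ler_piMl // ltW.
move: yP N1 N2 x2; rewrite !ler_norml natr_min natrX => /andP[].
set Y := _ / _ * _; set X := x * _; move: Y X (2 ^+ m) (N m)%:R => Y X Z M y1 y2 N1 N2 x2.
by rewrite /Num.min; case: ltP => ZM; apply/andP; split; lra.
Qed.

(** * Reading coded strings recursively *)

Lemma size_le_code s : (size s <= CodeSeq.code s)%N.
Proof.
elim: s => //= x s IHs; rewrite -[(size s).+1]mul1n leq_mul ?expn_gt0 //.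
by rewrite ltnS (leq_trans IHs) // -addnn leq_addr.
Qed.

(** A tail is non-empty exactly when its code is at least 1, and the code itself is large enough to
    bound the loop. *)
Definition code_size c := (\sum_(0 <= i < c) (1 <= iter i code_tail c))%N.

Definition code_nth c i := code_head (iter i code_tail c).

Definition code_bits x c := (\sum_(0 <= i < code_size c) (code_nth c i == x) * 2 ^ i)%N.

Definition code_below x c := all (fun i => code_nth c i + 1 <= x)%N (iota 0 (code_size c)).

Lemma code_sizeE s : code_size (CodeSeq.code s) = size s.
Proof.
rewrite -[RHS](minn_idPr (size_le_code s)) -sum_ltn; apply: eq_bigr => i _.
rewrite iter_code_tail; congr nat_of_bool; case: (ltnP i (size s)) => [lt_is|le_si].
  by rewrite (drop_nth 0%N lt_is) code_gt0.
by rewrite drop_oversize.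
Qed.

Lemma code_nthE s i : (i < size s)%N -> code_nth (CodeSeq.code s) i = nth 0%N s i.
Proof. by move=> lt_is; rewrite /code_nth iter_code_tail (drop_nth 0%N lt_is) code_headE. Qed.

Lemma code_bitsE x s : code_bits x (CodeSeq.code s) = bits_num [seq y == x | y <- s].
Proof.
rewrite bits_numE size_map /code_bits code_sizeE big_nat [in RHS]big_nat.
apply: eq_bigr => i /= lt_is.
by rewrite code_nthE // (nth_map 0%N).
Qed.

Lemma code_belowE x s : code_below x (CodeSeq.code s) = all (fun y => y < x)%N s.
Proof.
rewrite /code_below code_sizeE; apply/allP/(all_nthP 0%N) => [sx i lt_is|sx i].
  by have := sx i; rewrite mem_iota /= code_nthE // addn1; apply.
by rewrite mem_iota /= => lt_is; rewrite code_nthE // addn1; apply: sx.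
Qed.

Lemma computable_code_size : computable (fun e => code_size (e 0%N)).
Proof.
have cT := computable_code_tail.
by rewrite /code_size; computability.
Qed.

Lemma computable_code_nth : computable (fun e => code_nth (e 0%N) (e 1%N)).
Proof.
have cT := computable_code_tail; have cH := computable_code_head.
by rewrite /code_nth; computability.
Qed.

Lemma computable_code_bits x : computable (fun e => code_bits x (e 0%N)).
Proof.
have cN := computable_code_nth; have cS := computable_code_size.
by rewrite /code_bits; computability.
Qed.

Lemma computable_code_below x : computable (fun e => code_below x (e 0%N)).
Proof.
have cN := computable_code_nth; have cS := computable_code_size.
by rewrite /code_below; computability.
Qed.

(** Every number codes some sequence of numbers, so only the size of its entries has to be
    tested. *)
Lemma string_codeP (Omega : alphabetType) c :
  reflect (exists s : seq Omega, string_code s = c) (code_below #|Omega| c).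
Proof.
rewrite -{2}(CodeSeq.decodeK c) code_belowE; apply: (iffP allP) => [lt_c|[s <-] x].
  exists [seq enum_val (i : 'I_#|Omega|) | i <- pmap insub (CodeSeq.decode c)].
  rewrite /string_code -[RHS]CodeSeq.decodeK; congr CodeSeq.code.
  elim: (CodeSeq.decode c) lt_c => //= x s IHs lt_s.
  rewrite insubT ?lt_s ?mem_head // => lt_x /=.
  by rewrite enum_valK IHs // => y ys; rewrite lt_s // inE ys orbT.
by rewrite /string_code CodeSeq.codeK => /mapP[a _ ->].
Qed.

Lemma code_bits_string (Omega : alphabetType) (a : Omega) s :
  code_bits (enum_rank a) (string_code s) = bits_num (letter_bits a s).
Proof.
rewrite code_bitsE -map_comp; congr bits_num; apply: eq_map => b /=.
by rewrite (inj_eq (@ord_inj _)) (inj_eq enum_rank_inj).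
Qed.

Lemma code_size_string (Omega : alphabetType) (s : seq Omega) :
  code_size (string_code s) = size s.
Proof. by rewrite code_sizeE size_map. Qed.

(** * The Borel-Cantelli principle *)

Section BorelCantelli.
Context (R : realType) (Omega : alphabetType) (P : Omega -> R).
Context (hP : finite_probability P).
Context (P_computable : computable_probability P).
Context (mu : probability (infseq Omega) R).
Context (mu_bernoulli : bernoulli_measure P mu).
Context (a : Omega) (l : nat -> nat) (Q : nat -> pred (seq bool)) (c : nat).
Context (l_homo : {homo l : i j / (i <= j)%N}).
Context (l_computable : computable (fun e => l (e 0%N))).
Context (Q_computable : computable (fun e => Q (e 0%N) (bits (e 1%N) (l (e 0%N))))).
Context (Q_small : forall j, bexp (P a) (l j) (fun s => (Q j s)%:R) <= 2 ^+ c * 2 ^- j).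

Let p01 := letter_prob01 hP a.

(** Finite stage of the union of the events from index [J] on. *)
Let hits J d (s : seq bool) : bool :=
  has (fun i => Q (J + i) (take (l (J + i)) s)) (iota 0 d).

Let hits_take J d L s : (l (J + d) <= L)%N -> hits J d (take L s) = hits J d s.
Proof.
move=> lL; apply: eq_in_has => i; rewrite mem_iota add0n => /= lt_id.
by rewrite take_takel // (leq_trans _ lL) // l_homo // leq_add2l ltnW.
Qed.

(** Union bound: the added events contribute the geometric sum of [2 ^ c * 2 ^- (J + i)] over
    [d <= i < d + e], whose closed form telescopes in the induction on [e]. *)
Let bexp_hits J d e :
  bexp (P a) (l (J + (d + e))) (fun s => (hits J (d + e) s)%:R) <=
  bexp (P a) (l (J + d)) (fun s => (hits J d s)%:R) +
  2 ^+ c * (2 * 2 ^- (J + d) - 2 * 2 ^- (J + d + e)).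
Proof.
elim: e => [|e IHe]; first by rewrite !addn0 subrr mulr0 addr0.
apply: (@le_trans _ _ (bexp (P a) (l (J + (d + e))) (fun s => (hits J (d + e) s)%:R) +
   2 ^+ c * 2 ^- (J + (d + e)))); last first.
  apply: le_trans (lerD IHe (lexx _)) _; rewrite -addrA lerD2l -mulrDr.
  rewrite ler_wpM2l ?exprn_ge0 // !addnA addnS exprS.
  have x0 : 2 ^+ (J + d + e) != 0 :> R by rewrite expf_neq0.
  rewrite le_eqVlt; apply/orP; left; apply/eqP; field.
  by rewrite x0 expf_neq0.
have le1 : (l (J + (d + e)) <= l (J + (d + e.+1)))%N by rewrite l_homo // !leq_add2l.
(* All the events are compared on strings of the greater length. *)
rewrite -(subnKC le1).
apply: le_trans (lerD (lexx _) (Q_small _)).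
rewrite -[X in _ <= X + _](bexp_take _ _ (l (J + (d + e.+1)) - l (J + (d + e)))).
rewrite -[X in _ <= _ + X](bexp_take _ _ (l (J + (d + e.+1)) - l (J + (d + e)))).
rewrite -bexpD; apply: le_bexp => // s _.
have -> : hits J (d + e.+1) s =
    hits J (d + e) (take (l (J + (d + e))) s) || Q (J + (d + e)) (take (l (J + (d + e))) s).
  by rewrite hits_take // /hits addnS -addn1 iotaD has_cat /= orbF.
by case: (Q _ _); case: (hits _ _ _); rewrite ?addr0 ?add0r ?lerDl.
Qed.

Let tail_event J d : set (infseq Omega) := letter_event a (l (J + d)) (hits J d).

Let tail_eventP J d (alpha : nat -> Omega) : tail_event J d alpha <->
  exists2 i, (i < d)%N & Q (J + i) (letter_bits a (mkseq alpha (l (J + i)))).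
Proof.
have takeE i : (i < d)%N ->
    take (l (J + i)) (letter_bits a (mkseq alpha (l (J + d)))) =
    letter_bits a (mkseq alpha (l (J + i))).
  move=> lt_id; rewrite /letter_bits /mkseq -!map_take take_iota (minn_idPl _) //.
  by rewrite l_homo // leq_add2l ltnW.
rewrite /tail_event /letter_event /hits /=; split=> [/hasP[i]|[i lt_id Qi]].
  by rewrite mem_iota /= add0n => lt_id; rewrite takeE // => Qi; exists i.
by apply/hasP; exists i; rewrite ?mem_iota //= takeE.
Qed.

Let tail_event_nondecreasing J : nondecreasing_seq (tail_event J).
Proof.
move=> d e le_de; apply/subsetPset => alpha /tail_eventP[i lt_id Qi].
by apply/tail_eventP; exists i => //; exact: leq_trans le_de.
Qed.

Let measurable_tail_event J d : measurable (tail_event J d).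
Proof. exact: (measurable_letter_event hP mu_bernoulli). Qed.

Let measure_tail_event J d :
  mu (tail_event J d) = (bexp (P a) (l (J + d)) (fun s => (hits J d s)%:R))%:E.
Proof. exact: (measure_letter_event hP mu_bernoulli). Qed.

(** However many events are added after stage [d], they contribute at most the geometric tail;
    continuity from below passes to the union. *)
Let measure_bigcup_tail J d : (mu (\bigcup_e tail_event J e) <=
  (bexp (P a) (l (J + d)) (fun s => (hits J d s)%:R) + 2 ^+ c * (2 * 2 ^- (J + d)))%:E)%E.
Proof.
apply: nondecreasing_measure_le => // e.
apply: (@le_trans _ _ (mu (tail_event J (d + e)))).
  apply: le_measure; rewrite ?inE //.
  by apply/subsetPset/tail_event_nondecreasing/leq_addl.
rewrite measure_tail_event lee_fin.
apply: le_trans (bexp_hits _ _ _) _; rewrite lerD2l ler_wpM2l ?exprn_ge0 //.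
by rewrite lerBlDr lerDl mulr_ge0 // invr_ge0 exprn_ge0.
Qed.

(** Starting at index [n + c + 2] makes the bounds of the events sum to [2 ^- n / 2]. *)
Let test : set (nat * seq Omega) := [set ns | (0 < ns.1)%N /\
  exists i, size ns.2 = l (ns.1 + c + 2 + i) /\ Q (ns.1 + c + 2 + i) (letter_bits a ns.2)].

Let test_cylinder n : (0 < n)%N ->
  cylinder (tsection test n) = \bigcup_e tail_event (n + c + 2) e.
Proof.
move=> n0; apply/seteqP; split=> alpha.
  move=> [m [_ /= [i [szm Qi]]]]; exists i.+1 => //; apply/tail_eventP.
  by exists i => //; rewrite -szm size_mkseq.
move=> [e _ /tail_eventP[i _ Qi]]; exists (l (n + c + 2 + i)); split => //.
by exists i; rewrite size_mkseq.
Qed.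

Let test_re : re_set test.
Proof.
have cB := computable_code_below #|Omega|; have cS := computable_code_size.
have cb := computable_code_bits (enum_rank a).
have cQ : computable (fun e => Q (e 0%N) (bits (e 1%N) (l (e 0%N)))) := Q_computable.
pose q j n := Q j (bits n (l j)).
have {}cQ : computable (fun e => q (e 0%N) (e 1%N)) by [].
(* Variable 0 is the searched index, variables 1 and 2 are [n] and the string code; the value 0
   means acceptance. *)
pose T e := nat_of_bool (~~ ((1 <= e 1)%N && (code_below #|Omega| (e 2) &&
  ((code_size (e 2) == l (e 1 + c + 2 + e 0)) && q (e 1 + c + 2 + e 0)%N
     (code_bits (enum_rank a) (e 2)))))%N).
have cT : computable T by rewrite /T; computability.
have [r rP] := computable_re 2 cT; exists r => v; rewrite -rP {rP}.
have vE : v = [tuple nth 0%N v 0; nth 0%N v 1].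
  by apply: eq_from_tnth => i; rewrite !(tnth_nth 0%N); case: i => -[|[|]].
rewrite /T /=; split.
  move=> [n [s [[/= n0 [i [si Qi]]] ->]]]; exists i => /=.
  apply/eqP; rewrite eqb0 negbK n0 /=; apply/and3P; split.
  - by apply/string_codeP; exists s.
  - by rewrite code_size_string si.
  - by rewrite code_bits_string /q -si -(size_map (fun x => x == a)) bits_numK.
move=> [i /eqP]; rewrite eqb0 negbK => /and4P[n0 /string_codeP[s sE] si Qi].
exists (nth 0%N v 0), s; split; last by rewrite sE.
split => //=; exists i; move: si Qi; rewrite -sE code_size_string => /eqP si.
by rewrite code_bits_string /q -si -(size_map (fun x => x == a)) bits_numK.
Qed.

(** The measure is approximated by stage [k + 1] evaluated at a dyadic bias: the omitted tail costs
    at most [2 ^- k / 4] and the change of bias at most [2 ^- k / 8]. *)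
Let test_measure_computable : exists2 f : nat -> nat -> rat, recursive_rat2 f &
    forall n k, (0 < n)%N ->
      `|fine (mu (cylinder (tsection test n))) - ratr (f n k)| < 2 ^- k.
Proof.
have [A [cA Ale Aclose]] := computable_real_dyadic p01 (P_computable a).
pose q j n := Q j (bits n (l j)).
have cQ : computable (fun e => q (e 0%N) (e 1%N)) := Q_computable.
have cl := l_computable.
pose cnt n L := (\sum_(0 <= i < L) odd (n %/ 2 ^ i))%N.
have cc : computable (fun e => cnt (e 0%N) (e 1%N)).
  by rewrite /cnt; computability; move=> e; rewrite expn_gt0.
pose L n k := l (n + c + 2 + (k + 1)).
have cL : computable (fun e => L (e 0%N) (e 1%N)) by rewrite /L; computability.
(* With this precision, [L] tosses with bias error [2 / 2 ^ m] cost at most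
   [2 ^ L * 2 / 2 ^ m = 2 ^- k / 8]. *)
pose m n k := (L n k + k + 4)%N.
have cm : computable (fun e => m (e 0%N) (e 1%N)) by rewrite /m; computability.
pose N n k := (\sum_(0 <= b < 2 ^ L n k)
  has (fun i => q (n + c + 2 + i)%N b) (iota 0 (k + 1)) *
  (A (m n k) ^ cnt b (L n k) * (2 ^ m n k - A (m n k)) ^ (L n k - cnt b (L n k))))%N.
have cN : computable (fun e => N (e 0%N) (e 1%N)) by rewrite /N; computability.
(* The predecessor compensates the successor in the denominators of [recursive_rat]. *)
pose D n k := ((2 ^ m n k) ^ L n k).-1.
have cD : computable (fun e => D (e 0%N) (e 1%N)) by rewrite /D; computability.
exists (fun n k => (N n k)%:R / (D n k).+1%:R).
  exists (fun v => N (nth 0%N v 0) (nth 0%N v 1)), (fun=> 0%N),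
    (fun v => D (nth 0%N v 0) (nth 0%N v 1)).
  split; [exact: (computable_recursive 2 cN) |
    exact: (computable_recursive 2 (computable_const 0)) |
    exact: (computable_recursive 2 cD) | ].
  by move=> v; rewrite !(tnth_nth 0%N) /= subr0.
move=> n k n0; rewrite test_cylinder //; set J := (n + c + 2)%N.
rewrite fmorph_div /= !ratr_nat prednK ?expn_gt0 ?expn_gt0 // natrX.
have NE : (N n k)%:R / (2 ^ m n k)%:R ^+ L n k =
    bexp ((A (m n k))%:R / (2 ^ m n k)%:R) (L n k) (fun s => (hits J (k + 1) s)%:R) :> R.
  rewrite bexp_dyadic ?expn_gt0 //; congr (_ / _).
  rewrite /N natr_sum; apply: eq_bigr => b _; rewrite natrM; congr (_%:R * _).
    congr nat_of_bool; apply: eq_in_has => i; rewrite mem_iota /= add0n => lt_i.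
    by rewrite take_bits // l_homo // leq_add2l ltnW.
  by rewrite count_bits.
rewrite NE {NE}.
set B' := bexp _ _ _; pose B := bexp (P a) (L n k) (fun s => (hits J (k + 1) s)%:R).
have muU := measure_bigcup_tail J (k + 1).
have muF : (B%:E <= mu (\bigcup_e tail_event J e))%E.
  rewrite -measure_tail_event; apply: le_measure; rewrite ?inE //.
    exact: bigcupT_measurable.
  exact: bigcup_sup.
have mufin : mu (\bigcup_e tail_event J e) \is a fin_num.
  by apply: fin_num_measure; exact: bigcupT_measurable.
rewrite -(fineK mufin) !lee_fin in muU muF.
have k0 : 0 < 2 ^- k :> R by rewrite invr_gt0 exprn_gt0.
have tailE : 2 ^+ c * (2 * 2 ^- (J + (k + 1))) <= 2 ^- k / 4 :> R.
  have -> : 2 ^+ c * (2 * 2 ^- (J + (k + 1))) = 2 ^- n * (2 ^- k / 4) :> R.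
    rewrite /J !exprD; field.
    by rewrite !expf_neq0.
  apply: ler_piMl; first by rewrite mulr_ge0 ?ltW // invr_gt0.
  by rewrite invf_le1 ?exprn_gt0 // exprn_ege1 // ler1n.
have A01 : 0 <= ((A (m n k))%:R / (2 ^ m n k)%:R : R) <= 1.
  by apply/andP; split; [exact: divr_ge0 | rewrite ler_pdivrMr ?ltr0n ?expn_gt0 // mul1r ler_nat].
have errE : `|B - B'| <= 2 ^- k / 8.
  apply: le_trans (bexp_perturb _ p01 A01 _) _.
    by move=> s; case: (hits _ _ _); rewrite ?lexx ?ler01.
  have pA : `|P a - (A (m n k))%:R / (2 ^ m n k)%:R| <= 2 / 2 ^+ m n k.
    rewrite ler_pdivlMr ?exprn_gt0 // -[X in _ * X]gtr0_norm ?exprn_gt0 // -normrM.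
    by rewrite mulrBl natrX mulfVK ?expf_neq0 // distrC.
  apply: (@le_trans _ _ (2 ^+ L n k * (2 / 2 ^+ m n k))).
    by apply: ler_pM => //; rewrite -natrX ler_nat ltnW // ltn_expl.
  rewrite /m !exprD le_eqVlt; apply/orP; left; apply/eqP; field.
  by rewrite !expf_neq0.
move: (fine _) muU muF k0 tailE errE => x muU muF k0 tailE.
rewrite -/B in muU *.
rewrite ler_norml ltr_norml => /andP[]; move: muU tailE.
move: (2 ^+ c * _) (2 ^- k) k0 => y z; lra.
Qed.

(** Passing the test at level [n] excludes every event of index at least [n + c + 2]. *)
Lemma schnorr_random_avoids (alpha : nat -> Omega) : schnorr_random mu alpha ->
  exists J, forall j, (J <= j)%N -> ~~ Q j (letter_bits a (mkseq alpha (l j))).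
Proof.
move=> /(_ test) []; last first.
  move=> n n0; rewrite test_cylinder // => notin; exists (n + c + 2)%N => j le_j.
  apply/negP => Qj; apply: notin; exists (j - (n + c + 2)).+1 => //.
  by apply/tail_eventP; exists (j - (n + c + 2))%N => //; rewrite subnKC.
split; last exact: test_measure_computable.
split; [by move=> n s [] | exact: test_re | move=> n n0].
(* Stage 0 is empty, so the tail bound alone controls the measure. *)
rewrite test_cylinder //; apply: le_lt_trans (measure_bigcup_tail _ 0) _.
rewrite lte_fin addn0 /hits /= bexp_cst add0r.
have n1 : 0 < 2 ^- n :> R by rewrite invr_gt0 exprn_gt0.
have -> : 2 ^+ c * (2 * 2 ^- (n + c + 2)) = 2 ^- n / 2 :> R.
  by rewrite !exprD; field; rewrite !expf_neq0.
lra.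
Qed.

End BorelCantelli.

(** * Deviation bounds for Schnorr random sequences *)

(* Integer form of [x <= |c - k p|], where [A / 2 ^ m] approximates [p]. *)
Definition far (A m x k c : nat) : bool :=
  (x * 2 ^ m + k * A <= c * 2 ^ m)%N || (x * 2 ^ m + c * 2 ^ m <= k * A)%N.

Section Far.
Context (R : realType) (p : R) (A m : nat).
Context (A_close : `|A%:R - p * 2 ^+ m| <= 2).

Let far_natr x k c : far A m x k c =
  (x%:R * 2 ^+ m <= `|c%:R * 2 ^+ m - k%:R * A%:R :> R|).
Proof.
rewrite ler_normr lerBrDr opprB lerBrDr -!natrX -!natrM -!natrD !ler_nat.
by rewrite /far.
Qed.

Let error_le k : (k.*2 <= 2 ^ m)%N -> `|k%:R * (A%:R - p * 2 ^+ m)| <= 2 ^+ m.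
Proof.
move=> km; rewrite normrM ger0_norm //.
apply: (@le_trans _ _ (k%:R * 2)); first by rewrite ler_wpM2l.
by rewrite -natrM muln2 -natrX ler_nat.
Qed.

Let split_error k c : c%:R * 2 ^+ m - k%:R * A%:R =
  2 ^+ m * (c%:R - p * k%:R) - k%:R * (A%:R - p * 2 ^+ m) :> R.
Proof. by ring. Qed.

(** Since [k.*2 <= 2 ^ m], replacing [p] by [A / 2 ^ m] moves [k p] by at most 1, which is the slack
    lost here and in the converse [dev_far]. *)
Lemma far_dev x k c : (k.*2 <= 2 ^ m)%N -> far A m x k c ->
  x%:R - 1 <= `|c%:R - p * k%:R|.
Proof.
move=> /error_le km; rewrite far_natr split_error => xm.
have m0 : 0 < 2 ^+ m :> R by rewrite exprn_gt0.
rewrite -(ler_pM2l m0) -[X in X * `|_|](gtr0_norm m0) -normrM mulrBr mulr1.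
rewrite lerBlDr [X in X <= _]mulrC (le_trans xm) // (le_trans (ler_normB _ _)) //.
by rewrite lerD2l.
Qed.

Lemma dev_far x k c : (k.*2 <= 2 ^ m)%N -> x%:R + 1 <= `|c%:R - p * k%:R| ->
  far A m x k c.
Proof.
move=> /error_le km xc; rewrite far_natr split_error.
have m0 : 0 < 2 ^+ m :> R by rewrite exprn_gt0.
apply: le_trans (lerB_dist _ _); rewrite lerBrDr (le_trans (lerD (lexx _) km)) //.
by rewrite normrM (gtr0_norm m0) -[X in _ + X]mul1r -mulrDl mulrC ler_pM2l.
Qed.

End Far.

Lemma computable_far (A m x k c : (nat -> nat) -> nat) :
  computable A -> computable m -> computable x -> computable k -> computable c ->
  computable (fun e => far (A e) (m e) (x e) (k e) (c e)).
Proof. by move=> *; rewrite /far; computability. Qed.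

Lemma letter_bits_count (Omega : alphabetType) (a : Omega) (alpha : nat -> Omega) k L :
  (k <= L)%N -> count id (take k (letter_bits a (mkseq alpha L))) =
    count_mem a (mkseq alpha k).
Proof.
move=> kL; rewrite /letter_bits -map_take count_map /mkseq -map_take take_iota.
by rewrite (minn_idPl kL); apply: eq_count.
Qed.

(** * Upper bound on deviations by Kolmogorov's inequality *)

Section UpperBound.
Context (R : realType) (Omega : alphabetType) (P : Omega -> R).
Context (hP : finite_probability P).
Context (P_computable : computable_probability P).
Context (mu : probability (infseq Omega) R).
Context (mu_bernoulli : bernoulli_measure P mu).

(** For [2 ^ (r (j + 1))] tosses and threshold [2 ^ ((u + 1) j)], Kolmogorov's inequality gives at
    most [2 ^ (r (j + 1) - 2 (u + 1) j) = 2 ^ (r - j)] with [r = 2 u + 1]. The final 2 is the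
    rounding slack of [far], lost once in each direction. *)
Lemma schnorr_random_deviation (alpha : nat -> Omega) (a : Omega) (u : nat) :
  schnorr_random mu alpha ->
  exists J, forall j k, (J <= j)%N -> (k <= 2 ^ ((2 * u + 1) * (j + 1)))%N ->
    `|(count_mem a (mkseq alpha k))%:R - P a * k%:R| < 2 ^+ ((u + 1) * j) + 2.
Proof.
move=> alpha_random; have p01 := letter_prob01 hP a.
have [A [cA Ale Aclose]] := computable_real_dyadic p01 (P_computable a).
pose r := (2 * u + 1)%N; pose l j := (2 ^ (r * (j + 1)))%N.
(* [2 ^ m] is twice the length, as the rounding bound requires; the extra 1 in [x] compensates the
   rounding in [far_dev]. *)
pose m j := (r * (j + 1) + 1)%N; pose x j := (2 ^ ((u + 1) * j) + 1)%N.
pose Q j s := has (fun k => far (A (m j)) (m j) (x j) k (count id (take k s)))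
  (iota 0 (l j + 1)).
have cl : computable (fun e => l (e 0%N)) by rewrite /l; computability.
have cm : computable (fun e => m (e 0%N)) by rewrite /m; computability.
have cx : computable (fun e => x (e 0%N)) by rewrite /x; computability.
have le_m j k : (k <= l j)%N -> (k.*2 <= 2 ^ m j)%N.
  by rewrite /m expnD muln2 leq_double.
have [|||//|J JP] :=
  @schnorr_random_avoids R Omega P hP P_computable mu mu_bernoulli a l Q r _ cl _ _ alpha.
- by move=> i j ij; rewrite leq_exp2l // leq_mul // leq_add2r.
- apply: (@computable_ext (fun e => has (fun k => far (A (m (e 0%N))) (m (e 0%N))
      (x (e 0%N)) k (\sum_(0 <= i < k) odd (e 1%N %/ 2 ^ i))) (iota 0 (l (e 0%N) + 1)))).
    move=> e; congr nat_of_bool; apply: eq_in_has => k.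
    by rewrite mem_iota add0n addn1 ltnS /= => kl; rewrite take_bits // count_bits.
  apply: (@computable_has _ (fun k e => far (A (m (e 0%N))) (m (e 0%N)) (x (e 0%N)) k
    (\sum_(0 <= i < k) odd (e 1%N %/ 2 ^ i)))); first by computability.
  by apply: computable_far; computability; move=> e; rewrite expn_gt0.
- move=> j; pose y : R := 2 ^+ ((u + 1) * j).
  have y0 : 0 < y by rewrite exprn_gt0.
  apply: (@le_trans _ _ (bexp (P a) (l j) (fun s => (exceeds (P a) y 0 s)%:R))).
    apply: le_bexp => // s sl; rewrite ler_nat.
    case: (boolP (Q j s)) => [/hasP[k]|//]; rewrite mem_iota add0n addn1 ltnS /= => kl.
    move=> /(far_dev (Aclose _) (le_m _ _ kl)) xk.
    rewrite (@exceeds_take _ _ _ _ _ k) ?sl // add0r /dev size_takel ?sl //.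
    by rewrite (le_trans _ xk) // natrD addrK natrX.
  apply: le_trans (bexp_kolmogorov _ _ p01 y0) _.
  rewrite expr0n add0r /y -exprM ler_pdivrMr ?exprn_gt0 //.
  have -> : (2 ^+ r / 2 ^+ j * 2 ^+ ((u + 1) * j * 2) : R) = (l j)%:R.
    rewrite /l natrX; have j0 : (2 : R) ^+ j != 0 by rewrite expf_neq0.
    apply: (mulfI j0); rewrite mulrA [X in X * _]mulrC mulfVK // -!exprD; congr (_ ^+ _).
    by rewrite /r; lia.
  case/andP: p01 => p0 p1.
  by rewrite ler_piMr // mulr_ile1 ?subr_ge0 // lerBlDr lerDl.
exists J => j k Jj kl; have := JP j Jj; apply: contraNT; rewrite -leNgt => xk.
apply/hasP; exists k; first by rewrite mem_iota add0n addn1 ltnS.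
rewrite letter_bits_count //; apply: (dev_far (Aclose _) (le_m _ _ kl)).
by rewrite natrD natrX -addrA.
Qed.

End UpperBound.

(** * Independent blocks between powers of 4 *)

Section CentralDeviation.
Context (R : realType) (p : R).
Context (p01 : 0 < p < 1).

(* Raising the bias by [4 / 2 ^ i] moves the mean of [3 * 4 ^ i] tosses by
   [12 * 2 ^ i] and costs only a bounded factor in probability. *)
Lemma block_deviation : exists (I : nat) (kappa : R), 0 < kappa <= 1 /\
  forall i, (I <= i)%N ->
    bexp p (3 * 4 ^ i) (fun s => (`|dev p s| < 9 * 2 ^+ i)%R%:R) <= 1 - kappa.
Proof.
have /andP[p0 p1] := p01; have q0 : 0 < 1 - p by rewrite subr_gt0.
have pq0 : 0 < p * (1 - p) by rewrite mulr_gt0.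
(* Each of the [3 * 4 ^ i] tosses costs [(4 / 2 ^ i)^2 / (p (1 - p))] in the exponent, in total
   [48 / (p (1 - p))]. *)
pose K := expR (48 / (p * (1 - p))).
have K1 : 1 <= K by rewrite -expR0 ler_expR divr_ge0 // ltW.
have K0 : 0 < K by exact: lt_le_trans K1.
(* The first witness keeps the raised bias at most 1. The second comes from [2 / 3 <= K b + 1 / 4],
   where [b] is the probability of a deviation of at least [9 * 2 ^ i]. *)
exists (Num.truncn (4 / (1 - p))).+1, (4 * K)^-1; split.
  by rewrite invr_gt0 mulr_gt0 //= invf_le1 ?mulr_gt0 //; lra.
move=> i le_i; pose d : R := 4 / 2 ^+ i; pose N := (3 * 4 ^ i)%N.
have z0 : 0 < 2 ^+ i :> R by rewrite exprn_gt0.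
have d0 : 0 < d by rewrite divr_gt0.
have NE : N%:R = 3 * (2 ^+ i) ^+ 2 :> R.
  by rewrite /N natrM natrX -exprM mulnC exprM -[X in _ = _ * X ^+ i]natrX.
have d1 : d <= 1 - p.
  rewrite ler_pdivrMr // mulrC -ler_pdivrMr //.
  apply: le_trans (ltW (truncnS_gt _)) _; rewrite -natrX ler_nat.
  by rewrite (leq_trans le_i) // ltnW // ltn_expl.
have q01 : 0 <= p + d <= 1 by apply/andP; split; lra.
pose A s := ~~ (`|dev p s| < 9 * 2 ^+ i).
have AK : bexp (p + d) N (fun s => (A s)%:R) <= K * bexp p N (fun s => (A s)%:R) + 4^-1.
  apply: bexp_change => //; rewrite addrAC subrr add0r.
  have e0 : 0 <= d ^+ 2 / (p * (1 - p)) by rewrite divr_ge0 ?sqr_ge0 // ltW.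
  apply: (@le_trans _ _ (expR (d ^+ 2 / (p * (1 - p))) ^+ N)).
    by rewrite lerXn2r ?nnegrE ?expR_ge0 ?addr_ge0 // expR_ge1Dx.
  rewrite -expRM_natl ler_expR NE mulrA ler_pM2r ?invr_gt0 //.
  rewrite /d le_eqVlt; apply/orP; left; apply/eqP; field.
  by rewrite gt_eqF.
(* Under the raised bias [dev p] has mean [12 * 2 ^ i], so staying below [9 * 2 ^ i] misses the mean
   by more than [3 * 2 ^ i]; by Chebyshev this has probability at most 1/3. *)
have Aq : 2 / 3 <= bexp (p + d) N (fun s => (A s)%:R).
  have x0 : 0 < 3 * 2 ^+ i :> R by rewrite mulr_gt0.
  have := bexp_chebyshev N q01 x0; rewrite NE.
  have -> : 3 * (2 ^+ i) ^+ 2 * ((p + d) * (1 - (p + d))) / (3 * 2 ^+ i) ^+ 2 =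
      (p + d) * (1 - (p + d)) / 3 by field; rewrite gt_eqF.
  have q1 : (p + d) * (1 - (p + d)) <= 1 by apply: mulr_ile1; lra.
  have : 1 <= bexp (p + d) N (fun s => (A s)%:R) +
      bexp (p + d) N (fun s => (3 * 2 ^+ i <= `|dev (p + d) s|)%R%:R).
    rewrite -bexpD -[leLHS](bexp_cst (p + d) N 1); apply: le_bexp => // s sN.
    rewrite /A; have [_|xq] := leP (3 * 2 ^+ i) `|dev (p + d) s|; first by rewrite lerDr.
    rewrite ltNge negbK; suff -> : 9 * 2 ^+ i <= `|dev p s| by rewrite addr0.
    have devE : dev p s = dev (p + d) s + 12 * 2 ^+ i.
      rewrite /dev sN NE /d; field; by rewrite gt_eqF.
    rewrite ler_normr devE; apply/orP; left; move: xq; rewrite ltr_norml => /andP[].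
    by move: (dev _ _) (2 ^+ i) => D z; lra.
  lra.
have notA : bexp p N (fun s => (`|dev p s| < 9 * 2 ^+ i)%R%:R) = 1 - bexp p N (fun s => (A s)%:R).
  apply/eqP; rewrite eq_sym subr_eq -bexpD -[X in X == _](bexp_cst p N 1); apply/eqP.
  by apply: eq_bexp => s _; rewrite /A; case: (_ < _); rewrite ?addr0 ?add0r.
rewrite -/N notA lerD2l lerN2 invfM.
move: Aq AK; move: (bexp _ _ _) (bexp _ _ _) => b b' h1 h2.
by rewrite ler_pdivrMr //; lra.
Qed.

(** The blocks are disjoint, hence independent, and their probabilities multiply. As
    [r > 1 / kappa], a group of [r] blocks gives [(1 - kappa)^r <= exp (- r kappa) <= 1 / (1 + r
    kappa) <= 1 / 2]. *)
Lemma blocks_deviation : exists (I : nat) (r : nat), forall I0 j, (I <= I0)%N ->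
  bexp p (4 ^ (I0 + r * j)) (fun s => (all (fun i =>
    `|dev p (drop (4 ^ (I0 + i)) (take (4 ^ (I0 + i.+1)) s))| < 9 * 2 ^+ (I0 + i))
      (iota 0 (r * j)))%:R) <= 2 ^- j.
Proof.
have [I [kappa [/andP[kappa0 kappa1] blockP]]] := block_deviation.
have p01' : 0 <= p <= 1 by case/andP: p01 => *; rewrite !ltW.
pose r := (Num.truncn kappa^-1).+1.
have r2 : (1 - kappa) ^+ r <= 2^-1.
  apply: (@le_trans _ _ (expR (- kappa) ^+ r)).
    by rewrite lerXn2r ?nnegrE ?expR_ge0 ?subr_ge0 // expR_ge1Dx.
  rewrite -expRM_natl mulrN expRN lef_pV2 ?posrE ?expR_gt0 //.
  apply: le_trans (expR_ge1Dx _); rewrite -[2]/(1 + 1) lerD2l.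
  by rewrite -ler_pdivrMr // div1r ltW // truncnS_gt.
exists I, r => I0 j II0.
pose good i s := `|dev p (drop (4 ^ (I0 + i)) (take (4 ^ (I0 + i.+1)) s))| < 9 * 2 ^+ (I0 + i).
suff prodP n : bexp p (4 ^ (I0 + n)) (fun s => (all (good ^~ s) (iota 0 n))%:R) <=
    (1 - kappa) ^+ n.
  apply: le_trans (prodP _) _; rewrite exprM -exprVn.
  by rewrite lerXn2r ?nnegrE ?exprn_ge0 ?subr_ge0.
elim: n => [|n IHn]; first by rewrite bexp_cst.
have fourE : (4 ^ (I0 + n.+1) = 4 ^ (I0 + n) + 3 * 4 ^ (I0 + n))%N.
  by rewrite addnS expnS; lia.
rewrite fourE exprSr.
rewrite (@eq_bexp _ p _ _ (fun s => (all (good ^~ (take (4 ^ (I0 + n)) s)) (iota 0 n))%:R *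
   (`|dev p (drop (4 ^ (I0 + n)) s)| < 9 * 2 ^+ (I0 + n))%R%:R)); last first.
  move=> s ss; rewrite -natrM mulnb -addn1 iotaD all_cat /= andbT; congr (_%:R).
  congr (nat_of_bool (_ && _)).
    apply: eq_in_all => i; rewrite mem_iota add0n /= => lt_in.
    by rewrite /good take_takel // leq_exp2l // leq_add2l.
  by rewrite add0n /good take_oversize // ss fourE.
rewrite (bexp_prod _ _ _ (fun s => (all (good ^~ s) (iota 0 n))%:R)
   (fun s => (`|dev p s| < 9 * 2 ^+ (I0 + n))%R%:R)).
apply: ler_pM => //; first by apply: bexp_ge0.
  by apply: bexp_ge0.
by apply: blockP; rewrite (leq_trans II0) // leq_addr.
Qed.

End CentralDeviation.

(** * Deviations of square-root size *)

Section LowerBound.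
Context (R : realType) (Omega : alphabetType) (P : Omega -> R).
Context (hP : finite_probability P).
Context (P_computable : computable_probability P).
Context (mu : probability (infseq Omega) R).
Context (mu_bernoulli : bernoulli_measure P mu).

(** Small deviations at all checkpoints [4 ^ (I0 + i)] force small deviations over the blocks
    between them, which has probability at most [2 ^- j]. A random sequence avoids this for large
    [j], so some checkpoint shows a large deviation; [I0 >= I] places it late enough. *)
Lemma schnorr_random_sqrt_deviation (alpha : nat -> Omega) (a : Omega) (I : nat) :
  0 < P a < 1 -> schnorr_random mu alpha ->
  exists2 i, (I <= i)%N &
    2 ^+ i <= `|(count_mem a (mkseq alpha (4 ^ i)))%:R - P a * (4 ^ i)%:R|.
Proof.
move=> Pa01 alpha_random; have p01 := letter_prob01 hP a.
have [I1 [r blocksP]] := blocks_deviation Pa01; pose I0 := maxn I I1.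
have [A [cA Ale Aclose]] := computable_real_dyadic p01 (P_computable a).
pose l j := (4 ^ (I0 + r * j))%N; pose m j := (2 * (I0 + r * j) + 1)%N.
(* There are [r * j] blocks and hence [r * j + 1] endpoints. *)
pose Q j s := all (fun i => ~~ far (A (m j)) (m j) (2 ^ (I0 + i) + 1) (4 ^ (I0 + i))
  (count id (take (4 ^ (I0 + i)) s))) (iota 0 (r * j + 1)).
have cl : computable (fun e => l (e 0%N)) by rewrite /l; computability.
have cm : computable (fun e => m (e 0%N)) by rewrite /m; computability.
have le_l i j : (i <= r * j)%N -> (4 ^ (I0 + i) <= l j)%N.
  by move=> ij; rewrite leq_exp2l // leq_add2l.
have le_m i j : (i <= r * j)%N -> ((4 ^ (I0 + i)).*2 <= 2 ^ m j)%N.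
  by move=> ij; rewrite /m [leqRHS]expnD muln2 leq_double expnM; exact: le_l.
have [|||//|J JP] :=
  @schnorr_random_avoids R Omega P hP P_computable mu mu_bernoulli a l Q 0 _ cl _ _ alpha.
- by move=> i j ij; rewrite leq_exp2l // leq_add2l leq_mul.
- apply: (@computable_ext (fun e => all (fun i => ~~ far (A (m (e 0%N))) (m (e 0%N))
      (2 ^ (I0 + i) + 1) (4 ^ (I0 + i)) (\sum_(0 <= k < 4 ^ (I0 + i)) odd (e 1%N %/ 2 ^ k)))
      (iota 0 (r * e 0%N + 1)))).
    move=> e; congr nat_of_bool; apply: eq_in_all => i.
    rewrite mem_iota add0n addn1 ltnS /= => ij.
    by rewrite take_bits ?count_bits // le_l.
  apply: (@computable_all _ (fun i e => ~~ far (A (m (e 0%N))) (m (e 0%N))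
      (2 ^ (I0 + i) + 1) (4 ^ (I0 + i)) (\sum_(0 <= k < 4 ^ (I0 + i)) odd (e 1%N %/ 2 ^ k))));
    first by computability.
  by apply/computable_negb/computable_far; computability; move=> e; rewrite expn_gt0.
- move=> j; rewrite expr0 mul1r; apply: le_trans (blocksP I0 j (leq_maxr _ _)).
  apply: le_bexp => // s sl; rewrite ler_nat.
  case: (boolP (Q j s)) => [/allP Qs|//]; rewrite lt0b; apply/allP => i.
  rewrite mem_iota add0n /= => ij.
  have small k : (k <= r * j)%N ->
      `|dev (P a) (take (4 ^ (I0 + k)) s)| < 2 ^+ (I0 + k) + 2.
    move=> kj; have /Qs : k \in iota 0 (r * j + 1) by rewrite mem_iota add0n addn1 ltnS.
    apply: contraNT; rewrite -leNgt => dk.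
    apply: (dev_far (Aclose _) (le_m _ _ kj)).
    rewrite natrD natrX -addrA (le_trans dk) // /dev size_takel // sl.
    exact: le_l.
  have le_M : (4 ^ (I0 + i) <= 4 ^ (I0 + i.+1))%N by rewrite leq_exp2l // leq_add2l.
  (* With [z = 2 ^ (I0 + i)], the endpoints deviate by less than [z + 2] and [2 z + 2], hence the
     block by less than [3 z + 4 <= 9 z]. *)
  have := small _ ij; have := small _ (ltnW ij).
  rewrite -(take_takel s le_M); set s' := take (4 ^ (I0 + i.+1)) s.
  rewrite -{2}(cat_take_drop (4 ^ (I0 + i)) s') dev_cat addnS exprS.
  have : 1 <= 2 ^+ (I0 + i) :> R by rewrite exprn_ege1 // ler1n.
  move: (2 ^+ _) (dev _ (take _ s')) (dev _ (drop _ s')) => z x y.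
  by rewrite !ltr_norml => z1 /andP[x1 x2] /andP[y1 y2]; apply/andP; split; lra.
have := JP J (leqnn J); rewrite -has_predC => /hasP[i].
rewrite mem_iota add0n addn1 ltnS /= => iJ; rewrite negbK letter_bits_count ?le_l //.
move=> /(far_dev (Aclose _) (le_m _ _ iJ)); rewrite natrD natrX addrK => far_i.
by exists (I0 + i)%N => //; rewrite (leq_trans (leq_maxl I I1)) // leq_addr.
Qed.

End LowerBound.

(** * The critical exponent 2 *)

Theorem theorem10 (R : realType) (Omega : alphabetType) (P : Omega -> R)
    (hP : finite_probability P) (P_nontrivial : nontrivial P)
    (P_computable : computable_probability P)
    (lambda_P : probability (infseq Omega) R)
    (lambda_P_bernoulli : bernoulli_measure P lambda_P)
    (alpha : nat -> Omega) (alpha_random : schnorr_random lambda_P alpha)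
    (t : R) (t_gt0 : 0 < t) :
  (exists2 M : nat, (0 < M)%N &
     forall n k : nat, (M <= n)%N -> (0 < k)%N -> n%:R `^ t <= k%:R ->
       forall a : Omega,
         `| (count_mem a (mkseq alpha k))%:R / k%:R - P a | < n%:R^-1)
  <-> 2 < t.
Proof.
have count_div a k (x : R) : (0 < k)%N ->
    (`|(count_mem a (mkseq alpha k))%:R / k%:R - P a| < x) =
    (`|(count_mem a (mkseq alpha k))%:R - P a * k%:R| < x * k%:R).
  move=> k0; have k0' : 0 < k%:R :> R by rewrite ltr0n.
  rewrite -(ltr_pM2r k0') -[X in _ * X < _](gtr0_norm k0') -normrM mulrBl mulfVK //.
  by rewrite gt_eqF.
split=> [[M M0 MP]|t2].
  rewrite ltNge; apply/negP => t_le2.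
  have [a Pa0] : exists a, 0 < P a.
    apply/not_existsP => P0; have [_] := hP; rewrite big1 => [/esym/eqP|a _].
      by rewrite oner_eq0.
    by apply/eqP; rewrite eq_le hP.1 andbT leNgt; apply/negP/P0.
  have Pa01 : 0 < P a < 1 by rewrite Pa0 P_nontrivial.
  have [i Mi] :=
    schnorr_random_sqrt_deviation hP P_computable lambda_P_bernoulli M Pa01 alpha_random.
  apply/negP; rewrite -ltNge.
  have two_i : (2 ^ i)%:R != 0 :> R by rewrite pnatr_eq0 expn_eq0.
  have four_i : (4 ^ i)%:R = (2 ^ i)%:R ^+ 2 :> R by rewrite -natrX -expnM mulnC expnM.
  (* Here the permitted deviation [k / n] is [2 ^ i], and [n ^ t <= n ^ 2 = k] because [t <= 2]. *)
  have := MP (2 ^ i)%N (4 ^ i)%N _ _ _ a.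
  rewrite count_div ?expn_gt0 //.
  have -> : (2 ^ i)%:R^-1 * (4 ^ i)%:R = 2 ^+ i :> R.
    by rewrite four_i expr2 mulKf // natrX.
  apply => //.
    by rewrite (leq_trans Mi) // ltnW // ltn_expl.
  rewrite four_i -powR_mulrn ?ler0n // ler_powR //.
  by rewrite ler1n expn_gt0.
(* With [s = 1 / t], having [u + 1 > 3 / (1 - 2 s)] yields [u + 2 <= (2 u + 1) (1 - s)], the
   comparison of exponents in [le_k]. *)
pose u := Num.truncn (3 / (1 - 2 / t)).
have /choice[J JP] a :=
  schnorr_random_deviation hP P_computable lambda_P_bernoulli a u alpha_random.
pose r := (2 * u + 1)%N.
(* The maximum makes the bound uniform in the letter, and the successor ensures [j >= 1] below. *)
pose J0 := (\max_a J a).+1; exists (2 ^ (r * J0))%N; first by rewrite expn_gt0.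
move=> n k Mn k0 nk a; rewrite count_div //.
have r0 : (0 < r)%N by rewrite /r addn1.
(* [j] locates [k] between [2 ^ (r j)] and [2 ^ (r (j + 1))]; it is at least [J0] because
   [k >= n >= 2 ^ (r * J0)]. *)
pose j := (trunc_log 2 k %/ r)%N.
have jk : (2 ^ (r * j) <= k)%N.
  have := @trunc_logP 2 k isT k0; apply: leq_trans.
  by rewrite leq_exp2l // mulnC -leq_divRL.
have kj : (k <= 2 ^ (r * (j + 1)))%N.
  apply: ltnW; have := @trunc_log_ltn 2 k isT; move/leq_trans; apply.
  by rewrite leq_exp2l // mulnC addn1 -ltn_divLR.
have n1 : (1 <= n)%N by apply: leq_trans Mn; rewrite expn_gt0.
have t0 : t != 0 by rewrite gt_eqF.
pose s := t^-1; have s0 : 0 < s by rewrite invr_gt0.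
have s2 : 2 * s < 1 by rewrite ltr_pdivrMr // mul1r.
have n_le : n%:R <= k%:R `^ s :> R.
  have -> : n%:R = (n%:R `^ t) `^ s :> R by rewrite -powRrM mulfV // powRr1.
  by apply: ge0_ler_powR => //; rewrite ?nnegrE ?powR_ge0 // ltW.
have nk' : (n <= k)%N.
  rewrite -(@ler_nat R); apply: le_trans nk; rewrite -[leLHS]powRr1 //.
  by apply: ler_powR; [rewrite ler1n | lra].
have Jj : (J0 <= j)%N.
  rewrite leq_divRL // mulnC; apply: trunc_log_max => //.
  exact: leq_trans Mn nk'.
have Jaj : (J a <= j)%N.
  by apply: leq_trans Jj; apply: leqW; exact: (leq_bigmax a).
apply: lt_le_trans (JP a _ _ Jaj kj) _.
have j1 : (1 <= j)%N by exact: leq_trans Jj.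
have le_k : 2 ^+ ((u + 2) * j) <= k%:R `^ (1 - s) :> R.
  apply: (@le_trans _ _ ((2 ^+ (r * j)) `^ (1 - s))); last first.
    apply: ge0_ler_powR; rewrite ?nnegrE ?exprn_ge0 //; first lra.
    by rewrite -natrX ler_nat.
  rewrite -!powR_mulrn // -powRrM; apply: ler_powR; first by rewrite ler1n.
  rewrite natrM [in leRHS]natrM [leRHS]mulrAC ler_wpM2r //.
  have u3 : 3 < (u%:R + 1) * (1 - 2 * s).
    by rewrite -ltr_pdivrMr ?subr_gt0 // natr1 truncnS_gt.
  have u0 : 0 <= u%:R * (1 - 2 * s) by rewrite mulr_ge0 // subr_ge0 ltW.
  have -> : r%:R = 2 * u%:R + 1 :> R by rewrite natrD natrM.
  rewrite natrD.
  move: u3 u0; move: (u%:R : R) => v; nra.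
(* The slack 2 is absorbed by doubling, and the doubling by one more factor [2 ^ j], as [j >= 1]. *)
apply: (@le_trans _ _ (2 ^+ ((u + 2) * j))).
  apply: (@le_trans _ _ (2 * 2 ^+ ((u + 1) * j))).
    rewrite mulr_natl [leRHS]mulr2n lerD2l -[leLHS]expr1 ler_eXn2l ?ltr1n //.
    by rewrite muln_gt0 addn1.
  by rewrite -exprS ler_eXn2l ?ltr1n //; nia.
have n0 : 0 < n%:R :> R by rewrite ltr0n.
(* From [n <= k ^ s] follows [k / n >= k ^ (1 - s)]. *)
rewrite mulrC ler_pdivlMr // mulrC.
have -> : k%:R = k%:R `^ s * k%:R `^ (1 - s) :> R.
  rewrite -powRD; first by rewrite subrKC powRr1.
  by rewrite subrKC oner_eq0.
by apply: ler_pM => //; rewrite exprn_ge0.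
Qed.
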